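(* Let $P$ be a finite patch of $M$ pentagons of the $\{5,4\}$ tiling with $N$ boundary edges, and fix a boundary pivot. For every choice of logical basis inputs $b\in\{\bar 0,\bar 1\}^M$ (one per pentagon), the boundary state $|b\rangle\in(\mathbb{C}^2)^{\otimes N}$ of the hyperbolic pentagon code is (up to a nonzero scalar) a Majorana dimer state vector. The pairing of Majorana modes is the same for all inputs $b$. Each input $b$ corresponds to a unique pattern of dimer parities: $b$ determines the parities of $|b\rangle$, and distinct inputs have distinct parity patterns.
   Context: Majorana operators. On $L$ spins, with Pauli operators $X_k,Y_k,Z_k$ on site $k$, put $\gamma_{2k-1}=Z_1\cdots Z_{k-1}X_k$ and $\gamma_{2k}=Z_1\cdots Z_{k-1}Y_k$. Majorana dimer state. A nonzero vector $|\psi\rangle\in(\mathbb{C}^2)^{\otimes L}$ is a Majorana dimer state vector if there are a partition $\Omega$ of $\{1,\dots,2L\}$ into $L$ pairs $(j,k)$ with $j<k$ (the pairing) and signs $p_{j,k}\in\{\pm1\}$ (the dimer parities) such that $(\gamma_j+\mathrm{i}\,p_{j,k}\gamma_k)|\psi\rangle=0$ for all $(j,k)\in\Omega$. These data determine $|\psi\rangle$ up to a scalar. Code states. $|\bar 0\rangle_5$ and $|\bar 1\rangle_5$ are the logical basis states of the $[[5,1,3]]$ code, whose stabilizers are the cyclic permutations of $X_1Z_2Z_3X_4$. They are the normalized Majorana dimer states on $5$ spins, unique up to phase, with dimers $(j,j+5)$, $j=1,\dots,5$, and parities $p_{j,j+5}=+1$ for all $j$ in the case of $|\bar 0\rangle_5$,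 and $p_{j,j+5}=(-1)^j$ in the case of $|\bar 1\rangle_5$. They have eigenvalue $+1$ and $-1$, respectively, under $Z_1\cdots Z_5$. Up to phase they are invariant under cyclic permutations of the five spins. Hyperbolic pentagon code (HyPeC) with fixed input. The $\{5,4\}$ tiling is the regular tiling of the hyperbolic plane by pentagons, four at each vertex. A patch $P$ is a finite, nonempty, edge-connected set of tiles whose union is a closed disk (for example, all tiles within a given edge-adjacency graph distance of a central tile). For an input $b\in\{\bar 0,\bar 1\}^M$, place on tile $t$ the five-index tensor of computational-basis amplitudes of $|\bar 0\rangle_5$ or $|\bar 1\rangle_5$ according to $b_t$. Its indices are attached to the five edges of the tile in clockwise order, starting from an arbitrary vertex (the choice only matters up to phase). For each edge shared by two tiles of $P$, contract the two corresponding indices, i.e. set them equal and sum over $\{0,1\}$. The resulting tensor has one index for each of the $N$ boundary edges. Ordering the boundary edges clockwise around the disk, starting from a chosen boundary vertex (the boundary pivot), its entries are the computational-basis amplitudes of the boundary state $|b\rangle\in(\mathbb{C}^2)^{\otimes N}$. *)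

(* Defs.v *)
(* MathComp / MathComp-Analysis *)
From HB Require Import structures.
From mathcomp Require Import all_boot all_order all_algebra finmap.
From mathcomp Require Import all_classical all_reals all_analysis.
From mathcomp Require Import complex.
Import Order.TTheory GRing.Theory Num.Theory.
Import numFieldNormedType.Exports.

Set Implicit Arguments.
Unset Strict Implicit.
Unset Printing Implicit Defensive.

Local Open Scope classical_set_scope.
Local Open Scope ring_scope.

(** ** Spins and Majorana operators *)

Definition config (L : nat) := {ffun 'I_L -> 'I_2}.

(* A vector of (C^2)^{(x) L}, given by its computational-basis amplitudes. *)
Definition state (R : realType) (L : nat) := {ffun config L -> R[i]}.

Definition pauliX (R : realType) : 'M[R[i]]_2 :=
  \matrix_(a, b) (if a == b then 0 else 1).

Definition pauliY (R : realType) : 'M[R[i]]_2 :=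
  \matrix_(a, b) (if a == b then 0 else if a == 0 then - 'i%C else 'i%C).

Definition pauliZ (R : realType) : 'M[R[i]]_2 :=
  \matrix_(a, b) (if a == b then (-1) ^+ a else 0).

(* The action of the tensor product of the one-site operators A k on psi. *)
Definition tensor_op (R : realType) (L : nat) (A : 'I_L -> 'M[R[i]]_2)
    (psi : state R L) : state R L :=
  [ffun x : config L =>
     \sum_(y : config L) (\prod_(k < L) A k (x k) (y k)) * psi y].

(* Modes are numbered from 0: majorana 2k = Z_0 ... Z_(k-1) X_k and
   majorana (2k+1) = Z_0 ... Z_(k-1) Y_k, for k < L. *)
Definition majorana (R : realType) (L : nat) (m : 'I_(2 * L)) :
    state R L -> state R L :=
  tensor_op (fun k : 'I_L =>
    if (k < m./2)%N then pauliZ R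
    else if k == m./2 :> nat then (if odd m then pauliY R else pauliX R)
    else 1%:M).

(** ** Majorana dimer states *)

(* Each pair {j, k} of the partition is recorded once, as (j, k) with j < k. *)
Definition pairing (L : nat) (Omega : {set 'I_(2 * L) * 'I_(2 * L)}) : Prop :=
  (forall d, d \in Omega -> (d.1 < d.2)%N) /\
  (forall m : 'I_(2 * L),
     exists! d, d \in Omega /\ (m = d.1 \/ m = d.2)).

Definition dimer (L : nat) (Omega : {set 'I_(2 * L) * 'I_(2 * L)}) :=
  {d : 'I_(2 * L) * 'I_(2 * L) | d \in Omega}.

(* The dimer parity of d is the sign (-1) ^+ p d. *)
Definition parities (L : nat) (Omega : {set 'I_(2 * L) * 'I_(2 * L)}) :=
  {ffun dimer Omega -> bool}.

Definition majorana_dimer (R : realType) (L : nat)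
    (Omega : {set 'I_(2 * L) * 'I_(2 * L)}) (p : parities Omega)
    (psi : state R L) : Prop :=
  [/\ pairing Omega, psi != 0 &
      forall (d : dimer Omega) (x : config L),
        majorana (val d).1 psi x
        + 'i%C * (-1) ^+ p d * majorana (val d).2 psi x = 0].

(** ** Logical basis states of the [[5,1,3]] code *)

(* The r-th cyclic shift of X Z Z X 1 (subtraction in 'I_5 is modulo 5). *)
Definition stabilizer (R : realType) (r : 'I_5) : state R 5 -> state R 5 :=
  tensor_op (fun k : 'I_5 =>
    nth 1%:M [:: pauliX R; pauliZ R; pauliZ R; pauliX R; 1%:M]
      (k - r)%R).

(* The input c = false stands for the logical 0, and c = true for the
   logical 1; they are told apart by Z_1 ... Z_5, and a phase is left free. *)
Definition code_state (R : realType) (c : bool) (psi : state R 5) : Prop :=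
  [/\ \sum_(x : config 5) `|psi x| ^+ 2 = 1,
      forall r : 'I_5, stabilizer r psi = psi &
      forall x : config 5,
        tensor_op (fun=> pauliZ R) psi x = (-1) ^+ c * psi x].

(** ** The {5,4} tiling, in the hyperboloid model *)

Definition minkowski_form (R : realType) : 'M[R]_3 :=
  \matrix_(i, j) (if i == j then (if i == ord_max then -1 else 1) else 0).

Definition mink (R : realType) (x y : 'cV[R]_3) : R :=
  (x^T *m minkowski_form R *m y) 0 0.

Definition hyperbolic_plane (R : realType) : set 'cV[R]_3 :=
  [set x | mink x x = -1 /\ 0 < x ord_max 0].

(* Outward unit normals of the sides of the regular right-angled pentagon
   centred at (0, 0, 1).  With c^2 = 1 / (1 - cos (2 pi / 5)) and s^2 = c^2 - 1,
   the k-th one is (c cos t, - c sin t, s) with t = 2 pi k / 5, so that they are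
   numbered clockwise and consecutive ones are orthogonal for mink. *)
Definition normal (R : realType) (k : 'I_5) : 'cV[R]_3 :=
  let t := 2 * pi * k%:R / 5 : R in
  let q := cos (2 * pi / 5) : R in
  \col_(i < 3) nth 0 [:: Num.sqrt (1 / (1 - q)) * cos t;
                         - Num.sqrt (1 / (1 - q)) * sin t;
                         Num.sqrt (q / (1 - q))] i.

(* The reflection x |-> x - 2 (mink (normal k) x) (normal k). *)
Definition reflection (R : realType) (k : 'I_5) : 'M[R]_3 :=
  1 - 2 *: (normal R k *m (normal R k)^T *m minkowski_form R).

(* A tile is named by the element g of the group generated by the reflections
   in the sides of the central pentagon that maps the central pentagon onto
   it.  Since the angles are pi / 2, four tiles meet at each vertex. *)
Definition tile (R : realType) (g : 'M[R]_3) : Prop :=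
  exists w : seq 'I_5, g = \prod_(k <- w) reflection R k.

Definition region (R : realType) (g : 'M[R]_3) : set 'cV[R]_3 :=
  [set x | hyperbolic_plane x /\
           forall k : 'I_5, mink (g *m normal R k) x <= 0].

(* A side (g, k) is the image under g of the k-th side of the central
   pentagon. *)
Definition side (R : realType) := ('M[R]_3 * 'I_5)%type.

(* The other tile at the side (g, k) is the mirror image of g in that side,
   g r g^-1 g = g r with r = reflection k; the label of the side is still k. *)
Definition cross (R : realType) (d : side R) : side R :=
  (d.1 *m reflection R d.2, d.2).

(* The side that follows d clockwise around its tile; orientation-reversing
   elements g list the sides counterclockwise. *)
Definition turn (R : realType) (d : side R) : side R :=
  (d.1, if \det d.1 == 1 then d.2 + 1 else d.2 - 1).

(** ** Patches *)

Definition closed_disk (R : realType) : set (R * R) :=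
  [set u | u.1 ^+ 2 + u.2 ^+ 2 <= 1].

Definition homeomorphic (T U : topologicalType) (A : set T) (B : set U) : Prop :=
  exists (f : T -> U) (h : U -> T),
    [/\ {within A, continuous f}, {within B, continuous h},
        (forall x, A x -> B (f x) /\ h (f x) = x) &
        (forall y, B y -> A (h y) /\ f (h y) = y)].

Definition adjacent_in (R : realType) (P : {fset 'M[R]_3}) : rel P :=
  fun g h => [exists k : 'I_5, val h == (cross (val g, k)).1].

Definition pentagon_patch (R : realType) (P : {fset 'M[R]_3}) : Prop :=
  [/\ (P != fset0)%fset,
      (forall g, g \in P -> tile g),
      (forall g h : P, connect (@adjacent_in R P) g h) &
      homeomorphic [set x | exists2 g, g \in P & region g x] (@closed_disk R)].

(** ** The boundary of a patch *)

Definition patch_side (R : realType) (P : {fset 'M[R]_3}) (d : P * 'I_5) :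
    side R := (val d.1, d.2).

Definition boundary_side (R : realType) (P : {fset 'M[R]_3}) (d : P * 'I_5) :
    Prop := (cross (patch_side d)).1 \notin P.

(* Clockwise successor along the boundary, with the patch on the right: from
   the end vertex of d, sweep through the tiles of P at that vertex until a
   side whose other tile is not in P is reached. *)
Definition next_boundary_side (R : realType) (P : {fset 'M[R]_3})
    (d e : P * 'I_5) : Prop :=
  exists n : nat,
    let sweep m := iter m (fun a => turn (cross a)) (turn (patch_side d)) in
    [/\ patch_side e = sweep n, boundary_side e &
        forall m, (m < n)%N -> (cross (sweep m)).1 \in P].

(* bd lists all boundary sides once each, clockwise around the patch; the
   boundary pivot is the initial vertex of its first entry. *)
Definition clockwise_boundary (R : realType) (P : {fset 'M[R]_3}) (N : nat)
    (bd : N.-tuple (P * 'I_5)) : Prop :=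
  [/\ uniq bd,
      (forall d, d \in bd <-> boundary_side d) &
      forall i j : 'I_N, j = (i.+1 %% N)%N :> nat ->
        next_boundary_side (tnth bd i) (tnth bd j)].

(** ** The tensor network *)

(* The side carrying the j-th index of tile g, when index 0 is attached to the
   side numbered start g. *)
Definition leg (R : realType) (P : {fset 'M[R]_3}) (start : P -> 'I_5)
    (g : P) (j : 'I_5) : P * 'I_5 :=
  (g, (iter j (@turn R) (val g, start g)).2).

(* A value for every index of every tile, equal on contracted indices. *)
Definition index_values (R : realType) (P : {fset 'M[R]_3}) :=
  {ffun P * 'I_5 -> 'I_2}.

Definition contracted (R : realType) (P : {fset 'M[R]_3})
    (x : index_values P) : bool :=
  [forall d : P * 'I_5, forall e : P * 'I_5,
     (patch_side e == cross (patch_side d)) ==> (x d == x e)].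

Definition boundary_state (R : realType) (P : {fset 'M[R]_3}) (N : nat)
    (bd : N.-tuple (P * 'I_5)) (start : P -> 'I_5)
    (code : bool -> state R 5) (b : {ffun P -> bool}) : state R N :=
  [ffun y : config N =>
     \sum_(x : index_values P |
             contracted x && [forall i : 'I_N, x (tnth bd i) == y i])
       \prod_(g : P) code (b g) [ffun j : 'I_5 => x (leg start g j)]].

(* Main.v *)
(** By its stabilizers, the amplitude of a code state at u is, up to a constant,
    (-1) ^ (sum_k u_k u_(k+1)) on the configurations u of the right parity; so
    the tile tensors do not depend on the starting vertex or the orientation.

    Pairing.  Each dimer follows one side of a line of the tiling: it joins the
    two ends of a maximal row of tiles of the patch along that line.  Flipping
    the edges crossed by the row multiplies each term of the contraction by a
    sign, the parity of the edge values on one side of the row.  The line-side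
    edges of the row and a part of the boundary form a closed walk of sides,
    which bounds a set of tiles (the tiling being planar); adding the tile
    parities over this set turns the sign into a Jordan-Wigner string on the
    boundary, times a sign that depends only on the input.

    Planarity is extracted from the reflection group: every root is positive or
    negative, so each line separates the tiles into two half-planes, and modulo
    coboundaries of sets of tiles a side is the sum of two rays, one at each of
    its end vertices.

    Nonvanishing and orthogonality.  In a set of tiles, one at minimal Minkowski
    product with the centre (the farthest one) meets the others in at most two
    consecutive sides.  Any two legs of a code state are maximally entangled
    with the other three, and the two code states are indistinguishable on two
    legs; so the inner product of two boundary states is computed by removing
    the tiles one by one, and is nonzero if and only if the inputs agree.

    Injectivity.  Two Majorana dimer states with the same pairing and parities
    are not orthogonal. *)
Require Import Defs.
From HB Require Import structures.
From mathcomp Require Import all_boot all_order all_algebra finmap.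
From mathcomp Require Import all_classical all_reals all_analysis.
From mathcomp Require Import complex ring lra zify.
Import Order.TTheory GRing.Theory Num.Theory.
Import numFieldNormedType.Exports.

Set Implicit Arguments.
Unset Strict Implicit.
Unset Printing Implicit Defensive.

Local Open Scope ring_scope.

(** * The reflection group *)

(** Side labels are added cyclically; with the five cases given as ring numerals, identities between
    labels reduce to computation. *)
Lemma ord5_ind (Q : 'I_5 -> Prop) :
  Q 0 -> Q 1 -> Q 2 -> Q 3 -> Q 4 -> forall k, Q k.
Proof.
move=> Q0 Q1 Q2 Q3 Q4 [[|[|[|[|[|//]]]]] h].
- by rewrite (_ : Ordinal h = 0) //; apply: val_inj.
- by rewrite (_ : Ordinal h = 1) //; apply: val_inj.
- by rewrite (_ : Ordinal h = 2) //; apply: val_inj.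
- by rewrite (_ : Ordinal h = 3) //; apply: val_inj.
- by rewrite (_ : Ordinal h = 4) //; apply: val_inj.
Qed.

(** * The Minkowski form and the normals of the central pentagon *)

Section Mink.
Variable R : realType.
Implicit Types (x y z : 'cV[R]_3) (a : R).

Lemma minkE x y : mink x y =
  x 0 0 * y 0 0 + x 1 0 * y 1 0 - x ord_max 0 * y ord_max 0.
Proof.
rewrite /mink mxE.
have -> : \sum_j (x^T *m minkowski_form R) 0 j * y j 0 =
  \sum_(j < 3) (if j == ord_max then - 1 else 1) * x j 0 * y j 0.
  apply: eq_bigr => j _; rewrite mxE (bigD1 j) //= big1 => [|i /negPf ij].
    by rewrite addr0 !mxE eqxx [x j 0 * _]mulrC.
  by rewrite !mxE ij mulr0.
rewrite !big_ord_recr big_ord0 /= add0r !mul1r mulN1r mulNr.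
by congr (_ * _ + _ * _ - _); congr (_ _ _); apply: val_inj.
Qed.

Lemma minkC x y : mink x y = mink y x.
Proof. by rewrite !minkE; ring. Qed.

Lemma minkDl x y z : mink (x + y) z = mink x z + mink y z.
Proof. by rewrite !minkE !mxE; ring. Qed.

Lemma minkZl a x y : mink (a *: x) y = a * mink x y.
Proof. by rewrite !minkE !mxE; ring. Qed.

Lemma minkZr a x y : mink x (a *: y) = a * mink x y.
Proof. by rewrite !minkE !mxE; ring. Qed.

Lemma minkNl x y : mink (- x) y = - mink x y.
Proof. by rewrite -scaleN1r minkZl mulN1r. Qed.

Lemma minkNr x y : mink x (- y) = - mink x y.
Proof. by rewrite -scaleN1r minkZr mulN1r. Qed.

Lemma minkBl x y z : mink (x - y) z = mink x z - mink y z.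
Proof. by rewrite minkDl minkNl. Qed.

Lemma minkBr x y z : mink x (y - z) = mink x y - mink x z.
Proof. by rewrite minkC minkBl ![mink _ x]minkC. Qed.

Lemma reflectionE k x :
  reflection R k *m x = x - (2 * mink (normal R k) x) *: normal R k.
Proof.
rewrite /reflection mulmxBl mul1mx -scalemxAl -!mulmxA -scalerA; congr (_ - _ *: _).
rewrite !mulmxA -[mink _ _]/((_ *m x) 0 0) -[_ *m _ *m _ *m x]mulmxA -mulmxA.
rewrite [X in _ *m X]mx11_scalar.
by rewrite -!mulmxA mul_mx_scalar !mulmxA.
Qed.

(** The golden ratio, which is the hyperbolic cosine of the distance between the lines of two
    non-adjacent sides of the pentagon. *)
Definition kappa : R := 1 + 2 * cos (2 * pi / 5).

Let q : R := cos (2 * pi / 5).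

Lemma cos_fifth_gt0 : 0 < q.
Proof.
apply: cos_gt0_pihalf; have := pi_gt0 R.
by move=> ?; apply/andP; split; lra.
Qed.

Lemma cos_fifth_lt1 : q < 1.
Proof.
have p := pi_gt0 R; rewrite /q -[ltRHS](cos0 R) ltr_cos ?in_itv /=; try (apply/andP; split); lra.
Qed.

Lemma kappa_gt1 : 1 < kappa.
Proof. by rewrite /kappa -/q; have := cos_fifth_gt0; lra. Qed.

Lemma cos_fifths (m : nat) : (m < 5)%N ->
  cos (2 * pi * m%:R / 5 : R) =
  if m == 0 then 1 else if (m == 1) || (m == 4) then q else 2 * q ^+ 2 - 1.
Proof.
have c2 : cos (2 * (2 * pi / 5)) = 2 * q ^+ 2 - 1 :> R.
  by rewrite [2 * (_ / _)]mulr_natl cos_mulr2n -/q; ring.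
have cc (x : R) : cos (2 * pi - x) = cos x.
  by rewrite mulr_natl cosB cos2pi sin2pi mul1r mul0r addr0.
case: m => [|[|[|[|[|//]]]]] _ /=.
- by rewrite mulr0 mul0r cos0.
- by rewrite mulr1.
- by rewrite -c2; congr cos; lra.
- by rewrite -cc -c2; congr cos; lra.
- by rewrite -cc /q; congr cos; lra.
Qed.

(** The product depends only on the angle between the normals: it is [(cos - q) / (1 - q)], where
    the cosine takes the values [1], [q] and [2 * q ^+ 2 - 1]. *)
Lemma mink_normal (k j : 'I_5) : mink (normal R k) (normal R j) =
  if j == k then 1 else if (j == k + 1) || (j == k - 1) then 0 else - kappa.
Proof.
have q0 := cos_fifth_gt0; have q1 := cos_fifth_lt1.
have h : mink (normal R k) (normal R j) =
   (cos (2 * pi * `|k%:R - j%:R| / 5) - q) / (1 - q).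
  have -> : cos (2 * pi * `|k%:R - j%:R| / 5) =
            cos (2 * pi * k%:R / 5 - 2 * pi * j%:R / 5) :> R.
    case: (ger0P (k%:R - j%:R : R)) => _; last rewrite -cosN.
      by congr cos; ring.
    by congr cos; ring.
  rewrite minkE !mxE /= cosB -/q.
  set s1 := Num.sqrt (1 / _); set s2 := Num.sqrt (q / _).
  have e1 : s1 ^+ 2 = 1 / (1 - q) by rewrite sqr_sqrtr // divr_ge0 //; lra.
  have e2 : s2 ^+ 2 = q / (1 - q) by rewrite sqr_sqrtr // divr_ge0 //; lra.
  set A := cos _; set B := cos _; set C := sin _; set D := sin _.
  transitivity (s1 ^+ 2 * (A * B + C * D) - s2 ^+ 2); first by ring.
  by rewrite e1 e2; field; lra.
have q1' : 1 - q != 0 by lra.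
have z : (q - q) / (1 - q) = 0 by rewrite subrr mul0r.
have o : (1 - q) / (1 - q) = 1 by rewrite divff.
have w : (2 * q ^+ 2 - 1 - q) / (1 - q) = - kappa by rewrite /kappa -/q; field.
rewrite h.
have d : cos (2 * pi * `|k%:R - j%:R| / 5) =
     if j == k then 1 else if (j == k + 1) || (j == k - 1) then q
     else 2 * q ^+ 2 - 1.
    (* One of the two truncated differences is zero, so their sum is the distance of the labels, to
       which [cos_fifths] applies. *)
    have -> : `|k%:R - j%:R| = ((k - j) + (j - k))%N%:R :> R.
      case: (leqP j k) => kj.
        rewrite (_ : (j - k)%N = 0%N) ?addn0; last by apply/eqP; rewrite subn_eq0.
        by rewrite natrB // ger0_norm // subr_ge0 ler_nat.
      rewrite (_ : (k - j)%N = 0%N) ?add0n; last first.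
        by apply/eqP; rewrite subn_eq0 ltnW.
      by rewrite distrC natrB ?ger0_norm ?subr_ge0 ?ler_nat // ltnW.
    rewrite cos_fifths; last by case: k j {h} => ? ? [? ?] /=; lia.
    by move: k j {h}; elim/ord5_ind; elim/ord5_ind.
  by rewrite d; case: ifP => _ //; case: ifP.
Qed.
End Mink.

Definition side_adj (k j : 'I_5) : bool := (j == k + 1) || (j == k - 1).

Lemma side_adjC k j : side_adj k j = side_adj j k.
Proof. by move: k j; elim/ord5_ind; elim/ord5_ind. Qed.

Lemma side_adjP (k j : 'I_5) :
  [\/ j = k, side_adj k j, j = k + 2 | k = j + 2].
Proof.
have : [|| j == k, side_adj k j, j == k + 2 | k == j + 2].
  by move: k j; elim/ord5_ind; elim/ord5_ind.
by case/or4P => [/eqP|?|/eqP|/eqP]; [constructor 1|constructor 2|constructor 3|constructor 4].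
Qed.

(** * Roots and tiles of the reflection group *)

Section Group.
Variable R : realType.
Implicit Types (x y v : 'cV[R]_3) (a : R) (g h : 'M[R]_3) (i j k : 'I_5).

Let n := normal R.
Let r := reflection R.

Definition pentagon_center : 'cV[R]_3 := \col_i (i == ord_max)%:R.
Let e := pentagon_center.

Lemma mink_normal_self k : mink (n k) (n k) = 1.
Proof. by rewrite mink_normal eqxx. Qed.

Lemma mink_normal_adj k j : side_adj k j -> mink (n k) (n j) = 0.
Proof.
move=> kj; rewrite mink_normal; case: eqP => [jk|_]; last by rewrite -/(side_adj k j) kj.
by move: kj; rewrite jk; move: k {jk}; elim/ord5_ind.
Qed.

Lemma mink_normal_far k : mink (n k) (n (k + 2)) = - kappa R.
Proof. by rewrite mink_normal; move: k; elim/ord5_ind. Qed.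

Lemma mink_normal_center k : mink (n k) e < 0.
Proof.
rewrite minkE !mxE /= mulr0 mulr0 !add0r mulr1 oppr_lt0 sqrtr_gt0.
have := cos_fifth_gt0 R; have := cos_fifth_lt1 R => q1 q0.
by rewrite divr_gt0 // subr_gt0.
Qed.

Lemma reflection_invol k x : r k *m (r k *m x) = x.
Proof.
rewrite !reflectionE minkBr minkZr mink_normal_self mulr1.
rewrite (_ : 2 * (_ - _) = - (2 * mink (n k) x)) ?scaleNr ?opprK ?subrK //.
by rewrite -/n; ring.
Qed.

Lemma reflection_normal_self k : r k *m n k = - n k.
Proof.
by rewrite reflectionE mink_normal_self mulr1 scaler_nat mulr2n opprD addrA subrr add0r.
Qed.

Lemma reflection_normal_adj k j : side_adj k j -> r k *m n j = n j.
Proof. by move=> kj; rewrite reflectionE mink_normal_adj // mulr0 scale0r subr0. Qed.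

Lemma mink_reflection k x y : mink (r k *m x) (r k *m y) = mink x y.
Proof.
rewrite !reflectionE !minkBl !minkBr !minkZl !minkZr mink_normal_self [mink x (n k)]minkC.
by rewrite -/n; ring.
Qed.

Lemma mink_reflectionl k x y : mink (r k *m x) y = mink x (r k *m y).
Proof. by rewrite -{1}[y](reflection_invol k) mink_reflection. Qed.

Lemma mulmx_ext g h : (forall x, g *m x = h *m x) -> g = h.
Proof.
move=> gh; apply/matrixP => i j; have := gh (delta_mx j 0) => /matrixP/(_ i 0).
by rewrite -!colE !mxE.
Qed.

Lemma reflection_sqr k : r k *m r k = 1%:M.
Proof. by apply: mulmx_ext => x; rewrite -mulmxA reflection_invol mul1mx. Qed.

Lemma reflection_commute k j : side_adj k j -> r k *m r j = r j *m r k.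
Proof.
move=> kj; have jk := kj; rewrite side_adjC in jk.
apply: mulmx_ext => x; rewrite -!mulmxA !reflectionE !minkBr !minkZr.
rewrite !mink_normal_adj // !mulr0 !subr0 -!addrA; congr (_ + _).
by rewrite addrC.
Qed.

Lemma det33 (A : 'M[R]_3) : \det A =
  A 0 0 * (A 1 1 * A ord_max ord_max - A 1 ord_max * A ord_max 1)
  - A 0 1 * (A 1 0 * A ord_max ord_max - A 1 ord_max * A ord_max 0)
  + A 0 ord_max * (A 1 0 * A ord_max 1 - A 1 1 * A ord_max 0).
Proof.
pose a (i j : nat) := A (inord i) (inord j).
have E (i j : 'I_3) : A i j = a i j by rewrite /a !inord_val.
rewrite (expand_det_row _ 0) !big_ord_recl big_ord0 /cofactor.
rewrite !(expand_det_row _ 0) !big_ord_recl !big_ord0 /cofactor !det_mx11 !mxE.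
by rewrite !E /= /bump /=; ring.
Qed.

Lemma det_reflection k : \det (r k) = - 1.
Proof.
rewrite /r /reflection.
move: (normal R k) (mink_normal_self k : mink (normal R k) (normal R k) = 1) => v v1.
have E (i j : 'I_3) : (1 - 2 *: (v *m v^T *m minkowski_form R)) i j =
    (i == j)%:R - 2 * v i 0 * v j 0 * (if j == ord_max then - 1 else 1).
  rewrite !mxE (bigD1 j) //= big1 => [|l /negPf lj].
    by rewrite addr0 !mxE eqxx big_ord1 !mxE -!mulrA.
  by rewrite !mxE lj mulr0.
move: v1; rewrite minkE det33 !E /= => v1.
transitivity (1 - 2 * (v 0 0 * v 0 0 + v 1 0 * v 1 0 - v ord_max 0 * v ord_max 0)).
  by rewrite /=; ring.
by rewrite v1; ring.
Qed.

Lemma tile1 : tile (1%:M : 'M[R]_3).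
Proof. by exists [::]; rewrite big_nil. Qed.

Lemma tile_mul g h : tile g -> tile h -> tile (g *m h).
Proof. by move=> [w ->] [w' ->]; exists (w ++ w'); rewrite big_cat mulmxE. Qed.

Lemma tile_reflection k : tile (r k).
Proof. by exists [:: k]; rewrite big_seq1. Qed.

(** Extending a word on the left reflects the plane in a side of the central pentagon; extending it
    on the right, as in [tile_indr], crosses a side of the tile itself. *)
Lemma tile_ind (Q : 'M[R]_3 -> Prop) : Q 1%:M ->
  (forall k g, tile g -> Q g -> Q (r k *m g)) -> forall g, tile g -> Q g.
Proof.
move=> Q1 QM g [w ->]; elim: w => [|k w IH]; first by rewrite big_nil.
by rewrite big_cons -mulmxE; apply: QM IH; exists w.
Qed.

Lemma tile_indr (Q : 'M[R]_3 -> Prop) : Q 1%:M ->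
  (forall k g, tile g -> Q g -> Q (g *m r k)) -> forall g, tile g -> Q g.
Proof.
move=> Q1 QM g [w ->]; elim/last_ind: w => [|w k IH]; first by rewrite big_nil.
by rewrite -cats1 big_cat big_seq1 /= -mulmxE; apply: QM IH; exists w.
Qed.

Lemma tile_inv g : tile g -> exists h, [/\ tile h, g *m h = 1%:M & h *m g = 1%:M].
Proof.
move: g; apply: tile_ind => [|k g tg [h [th gh hg]]].
  by exists 1%:M; rewrite mulmx1; split => //; apply: tile1.
exists (h *m r k); split; first by apply: tile_mul th (tile_reflection k).
  by rewrite mulmxA -(mulmxA (r k)) gh mulmx1 reflection_sqr.
by rewrite mulmxA -(mulmxA h) reflection_sqr mulmx1.
Qed.

Lemma tile_mulI g x y : tile g -> g *m x = g *m y -> x = y.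
Proof.
move=> /tile_inv[h [_ _ hg]] /(congr1 (mulmx h)).
by rewrite !mulmxA hg !mul1mx.
Qed.

Lemma mink_tile g x y : tile g -> mink (g *m x) (g *m y) = mink x y.
Proof.
move=> tg; move: g tg x y; apply: tile_ind => [x y|k g _ IH x y].
  by rewrite !mul1mx.
by rewrite -!mulmxA mink_reflection IH.
Qed.

Lemma det_tile g : tile g -> \det g = 1 \/ \det g = - 1.
Proof.
move: g; apply: tile_ind => [|k g _ [] dg]; first by left; rewrite det1.
  by right; rewrite det_mulmx det_reflection dg mulr1.
by left; rewrite det_mulmx det_reflection dg mulrN1 opprK.
Qed.

(** The induction step shared by [pos_root_nonadj] and [upward_nonadj]. Reflecting in side [k]
    negates [b k], keeps the values at its two neighbours, and adds [2 * kappa R * b k] to the two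
    others, which is negative enough because [kappa] exceeds 1. *)
Lemma nonadj_step (b b' : 'I_5 -> R) k :
  (forall i, b i + b (i + 2) <= 0) -> b k < 0 ->
  (forall i, b' i = b i - 2 * mink (n k) (n i) * b k) ->
  forall i, b' i + b' (i + 2) <= 0.
Proof.
move=> bn bk b'E i; rewrite !b'E; have bi := bn i; have k1 := kappa_gt1 R.
have adj l : side_adj k l -> mink (n k) (n l) = 0 by exact: mink_normal_adj.
have p : kappa R * b k < 0 by rewrite pmulr_rlt0 // (lt_trans ltr01).
have : [|| k == i, k == i + 2, k == i + 1, k == i - 1 | k == i + 3].
  by move: i k {bi b'E adj p bk}; elim/ord5_ind; elim/ord5_ind.
case/or4P => [/eqP ki|/eqP ki|/eqP ki|/orP[/eqP ki|/eqP ki]].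
- rewrite -ki mink_normal_self mink_normal_far; rewrite -ki in bi; nra.
- rewrite -ki mink_normal_self ki [mink _ (n i)]minkC mink_normal_far -ki.
  rewrite -ki in bi; nra.
- rewrite !adj; [by lra|move: i {bi p b'E} ki; elim/ord5_ind => -> //..].
- rewrite (adj i); last by rewrite ki; move: i {bi p b'E ki}; elim/ord5_ind.
  have -> : mink (n k) (n (i + 2)) = - kappa R.
    rewrite minkC (_ : k = (i + 2) + 2) ?mink_normal_far // ki.
    by move: i {bi p b'E ki}; elim/ord5_ind; apply: val_inj.
  nra.
- rewrite (adj (i + 2)); last by rewrite ki; move: i {bi p b'E ki}; elim/ord5_ind.
  have -> : mink (n k) (n i) = - kappa R.
    rewrite (_ : i = k + 2) ?mink_normal_far // ki.
    by move: i {bi p b'E ki}; elim/ord5_ind; apply: val_inj.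
  nra.
Qed.

(* The positive roots, generated upwards from the simple ones; that reflections
   preserve them up to sign rests on pos_root_nonadj: a root cannot pair
   positively with two non-adjacent normals. *)
Inductive pos_root : 'cV[R]_3 -> Prop :=
| pos_normal k : pos_root (n k)
| pos_up k x : pos_root x -> mink (n k) x < 0 -> pos_root (r k *m x).

Lemma mink_step i k x :
  mink (n i) (r k *m x) = mink (n i) x - 2 * mink (n k) (n i) * mink (n k) x.
Proof. by rewrite reflectionE minkBr minkZr -/n [mink (n k) (n i)]minkC; ring. Qed.

Lemma pos_root_nonadj x : pos_root x ->
  forall i, mink (n i) x + mink (n (i + 2)) x <= 0.
Proof.
elim=> [k i|k {}x _ IH kx]; last first.
  by apply: (nonadj_step IH kx) => i; apply: mink_step.
have k1 := kappa_gt1 R.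
case: (side_adjP i k) => [->|ik|->|ik].
- by rewrite mink_normal_self [mink _ (n i)]minkC mink_normal_far; lra.
- rewrite mink_normal_adj // add0r.
  case: (side_adjP (i + 2) k) => [kE|ik2|kE|->].
  + by move: ik; rewrite kE; move: i {kE}; elim/ord5_ind.
  + by rewrite mink_normal_adj.
  + by rewrite kE mink_normal_far; lra.
  + by rewrite [mink _ (n k)]minkC mink_normal_far; lra.
- by rewrite mink_normal_self mink_normal_far; lra.
- have -> : mink (n i) (n k) = - kappa R by rewrite ik minkC mink_normal_far.
  suff /mink_normal_adj -> : side_adj (i + 2) k by lra.
  by rewrite ik; move: k {ik}; elim/ord5_ind.
Qed.

(** A simple reflection permutes the positive roots other than its own normal. Only a root pairing
    positively with [n j] needs an argument, and then [j] is compared with the last generating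
    reflection [k]. *)
Lemma pos_root_reflection j x : pos_root x -> x = n j \/ pos_root (r j *m x).
Proof.
move=> px; have k0 := kappa_gt1 R; elim: px j => [k|k {}x px IH kx] j.
  case: (side_adjP j k) => [->|jk|kj|jk]; first by left.
  - by right; rewrite reflection_normal_adj //; apply: pos_normal.
  - right; apply: pos_up; first exact: pos_normal.
    by rewrite kj mink_normal_far; lra.
  - right; apply: pos_up; first exact: pos_normal.
    by rewrite jk minkC mink_normal_far; lra.
right.
have pkx : pos_root (r k *m x) by apply: pos_up.
case: (ltrgt0P (mink (n j) (r k *m x))) => [jx|jx|jx]; last first.
- by rewrite [r j *m _]reflectionE jx mulr0 scale0r subr0.
- exact: pos_up.
case: (side_adjP j k) => [->|jk|kj|jk].
- by rewrite reflection_invol.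
(* For adjacent sides the reflections commute, and the step [k] is redone above [r j *m x]. *)
- have kj := jk; rewrite side_adjC in kj.
  move: jx; rewrite mink_step mink_normal_adj // mulr0 mul0r subr0 => jx.
  case: (IH j) => [xj|pjx].
    by move: kx; rewrite xj mink_normal_adj // ltxx.
  rewrite mulmxA -reflection_commute // -mulmxA; apply: pos_up => //.
  by rewrite mink_step mink_normal_adj // mulr0 mul0r subr0.
(* For non-adjacent sides both products with [r k *m x] would be positive. *)
- have := pos_root_nonadj pkx j; rewrite -kj; move: jx.
  rewrite [mink (n k) (_ *m _)]mink_step mink_normal_self => ? ?; lra.
- have := pos_root_nonadj pkx k; rewrite -jk; move: jx.
  rewrite [mink (n k) (_ *m _)]mink_step mink_normal_self => ? ?; lra.
Qed.

(** The centre is on the negative side of every side normal, and each generating step adds a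
    positive multiple of a side normal. *)
Lemma mink_pos_root x : pos_root x -> mink x e < 0.
Proof.
elim=> [k|k {}x _ xe kx]; first exact: mink_normal_center.
rewrite reflectionE minkBl minkZl -/n; have := mink_normal_center k; nra.
Qed.

Definition is_root x := pos_root x \/ pos_root (- x).

Lemma root_tile g k : tile g -> is_root (g *m n k).
Proof.
move: g; apply: tile_ind => [|j g _ []] .
- by left; rewrite mul1mx; apply: pos_normal.
- rewrite -mulmxA => /(pos_root_reflection j)[->|]; last by left.
  by right; rewrite reflection_normal_self opprK; apply: pos_normal.
- rewrite -mulmxA => /(pos_root_reflection j)[/(canRL (@opprK _)) ->|].
    by left; rewrite mulmxN reflection_normal_self opprK; apply: pos_normal.
  by rewrite mulmxN; right.
Qed.

Lemma mink_root_center g k : tile g -> mink (g *m n k) e != 0.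
Proof.
move=> /(root_tile k)[] /mink_pos_root; first by move/lt_eqF => ->.
by rewrite minkNl oppr_lt0 => /gt_eqF ->.
Qed.

(* Tiles reached from the central one by always crossing away from its centre. *)
Inductive upward : 'M[R]_3 -> Prop :=
| upward1 : upward 1%:M
| upwardM k g : upward g -> mink (g *m n k) e < 0 -> upward (g *m r k).

Lemma upward_tile_of g : upward g -> tile g.
Proof.
elim=> [|k {}g _ tg _]; first exact: tile1.
exact: tile_mul tg (tile_reflection k).
Qed.

Lemma mink_stepr i k g x : mink (g *m r k *m n i) x =
  mink (g *m n i) x - 2 * mink (n k) (n i) * mink (g *m n k) x.
Proof.
by rewrite -mulmxA reflectionE mulmxBr -scalemxAr minkBl minkZl.
Qed.

(** The same induction step as for roots, applied to the products of the five outward normals of one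
    tile with the centre. *)
Lemma upward_nonadj g : upward g ->
  forall i, mink (g *m n i) e + mink (g *m n (i + 2)) e <= 0.
Proof.
elim=> [i|k {}g _ IH kx]; last first.
  by apply: (nonadj_step IH kx) => i; apply: mink_stepr.
have := mink_normal_center i; have := mink_normal_center (i + 2).
by rewrite !mul1mx; lra.
Qed.

(** Parallel to [pos_root_reflection]: a crossing towards the centre undoes the last step, or
    commutes with it, or would make two non-adjacent sides of the tile face the centre. *)
Lemma upward_reflection j g : upward g -> upward (g *m r j).
Proof.
move=> ug; have k0 := kappa_gt1 R; elim: ug j => [|k {}g ug IH gk] j.
  by apply: upwardM; [exact: upward1|rewrite mul1mx mink_normal_center].
have ugk : upward (g *m r k) by apply: upwardM.
have := mink_root_center j (upward_tile_of ugk).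
case: (ltrgt0P (mink (g *m r k *m n j) e)) => // [jx|jx] _; last exact: upwardM.
case: (side_adjP j k) => [<-|jk|kj|jk].
- by rewrite -mulmxA reflection_sqr mulmx1.
- have kj := jk; rewrite side_adjC in kj.
  move: jx; rewrite mink_stepr mink_normal_adj // mulr0 mul0r subr0 => jx.
  rewrite -mulmxA -reflection_commute // mulmxA; apply: upwardM => //.
  by rewrite mink_stepr mink_normal_adj // mulr0 mul0r subr0.
- have := upward_nonadj ugk j; rewrite -kj; move: jx.
  rewrite [mink (_ *m n k) _]mink_stepr mink_normal_self => ? ?; lra.
- have := upward_nonadj ugk k; rewrite -jk; move: jx.
  rewrite [mink (_ *m n k) _]mink_stepr mink_normal_self => ? ?; lra.
Qed.

Lemma upward_tile g : tile g -> upward g.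
Proof.
move: g; apply: tile_indr => [|k g _]; [exact: upward1 | exact: upward_reflection].
Qed.

Lemma tile_nonadj g i : tile g ->
  ~ (0 < mink (g *m n i) e /\ 0 < mink (g *m n (i + 2)) e).
Proof. by move=> /upward_tile/upward_nonadj/(_ i) ? [? ?]; lra. Qed.

(** A last upward step would leave a side that separates the tile from the centre. *)
Lemma tile_fundamental g : tile g -> (forall i, mink (g *m n i) e < 0) -> g = 1%:M.
Proof.
move=> /upward_tile[] // k {}g _ gk /(_ k).
by rewrite -mulmxA reflection_normal_self mulmxN minkNl oppr_lt0 ltNge ltW.
Qed.
End Group.

(** * Lines of the tiling and their half-planes *)

Section Walls.
Variable R : realType.
Implicit Types (x y v : 'cV[R]_3) (g h t : 'M[R]_3) (i j k a : 'I_5).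

Let n := normal R.
Let r := reflection R.
Let e := pentagon_center R.

(** The tile [h] is tested by its centre, through which no line of the tiling passes. *)
Definition beyond g k h : bool := 0 < mink (g *m n k) (h *m e).

(* Side j of tile h and side k of tile g lie on the same line. *)
Definition same_wall g k h j : bool :=
  (h *m n j == g *m n k) || (h *m n j == - (g *m n k)).

(** Since [r j] permutes the positive roots other than [n j], the sign changes only at [n j] and its
    opposite. *)
Lemma reflection_root_sign j x : is_root x ->
  (0 < mink (r j *m x) e) = (0 < mink x e) (+) ((n j == x) || (n j == - x)).
Proof.
have pos y : pos_root y ->
    (0 < mink (r j *m y) e) = (0 < mink y e) (+) ((n j == y) || (n j == - y)).
  move=> py; have ye := mink_pos_root py; have [<-|ny] := eqVneq (n j) y.
    have nj := mink_normal_center R j.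
    by rewrite reflection_normal_self minkNl oppr_gt0 nj ltNge ltW.
  have -> : (n j == - y) = false.
    apply/eqP => nj; have := mink_normal_center R j.
    by rewrite -/n nj minkNl oppr_lt0 ltNge ltW.
  case: (pos_root_reflection j py) => [yn|/mink_pos_root ry]; first by rewrite yn eqxx in ny.
  by rewrite addbF !ltNge !ltW.
case=> [/pos //|px]; have := pos _ px; have h := mink_pos_root px.
have x0 : mink x e > 0 by move: h; rewrite minkNl oppr_lt0.
have nx : 0 < mink (- x) e = false by rewrite ltNge ltW.
rewrite nx mulmxN minkNl oppr_gt0 opprK x0 /= => rx.
rewrite orbC -rx.
have : mink (r j *m x) e != 0.
  case: (pos_root_reflection j px) => [xn|/mink_pos_root].
    by rewrite -[x]opprK xn mulmxN reflection_normal_self opprK lt_eqF // mink_normal_center.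
  by rewrite mulmxN minkNl oppr_lt0 => /gt_eqF ->.
by case: ltgtP.
Qed.

Lemma beyond_mul g h k t : tile h -> beyond (h *m g) k (h *m t) = beyond g k t.
Proof. by move=> th; rewrite /beyond -!mulmxA mink_tile. Qed.

(** Moving [h] to the central position reduces this to [reflection_root_sign]. *)
Lemma beyond_step g k h j : tile g -> tile h ->
  beyond g k (h *m r j) = beyond g k h (+) same_wall g k h j.
Proof.
move=> tg th; have [h' [th' hh' _]] := tile_inv th.
have -> : g = h *m (h' *m g) by rewrite mulmxA hh' mul1mx.
have tt : tile (h' *m g) by apply: tile_mul.
move: (h' *m g) tt => t tt {tg th' hh' g}.
rewrite beyond_mul // -{2}[h]mulmx1 beyond_mul // /beyond mul1mx.
rewrite -mink_reflectionl reflection_root_sign; last exact: root_tile.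
have eqm x y : (h *m x == h *m y) = (x == y).
  by apply/eqP/eqP => [/(tile_mulI th)|->].
by rewrite /same_wall -mulmxA -[- (h *m _)]mulmxN !eqm.
Qed.

Lemma beyond_adj g a k h : side_adj a k -> beyond (g *m r a) k h = beyond g k h.
Proof. by move=> ak; rewrite /beyond -mulmxA reflection_normal_adj. Qed.

Lemma same_wall_self g k h j : same_wall (g *m r k) k h j = same_wall g k h j.
Proof.
by rewrite /same_wall -mulmxA reflection_normal_self mulmxN opprK orbC.
Qed.

(** Distinct normals have product 0 or [- kappa], never 1 or -1; so distinct sides of a tile lie on
    distinct lines. *)
Lemma normal_neq k j : n k = n j \/ n k = - n j -> k = j.
Proof.
have k1 := kappa_gt1 R; have sf := mink_normal_self R.
case: (side_adjP k j) => [->//|kj|kj|kj].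
- case=> E; have := mink_normal_adj R kj; rewrite -/n E ?minkNl sf => ?; exfalso; lra.
- case=> E; have := mink_normal_far R k; rewrite -kj -/n E ?minkNl ?minkNr sf => ?; exfalso; lra.
- case=> E; have := mink_normal_far R j; rewrite -kj -/n E ?minkNr sf => ?; exfalso; lra.
Qed.

Lemma same_wall_inj g k k' h j : tile g ->
  same_wall g k h j -> same_wall g k' h j -> k = k'.
Proof.
move=> tg; rewrite /same_wall => /orP[] /eqP -> /orP[] /eqP; rewrite -?mulmxN => /(tile_mulI tg) E;
  apply: normal_neq; try (by left); try (by right).
- by right; rewrite -E opprK.
- by left; apply: oppr_inj.
Qed.

Lemma tile_reflection_neq g k : tile g -> g *m r k != g.
Proof.
move=> tg; apply/eqP => /(congr1 determinant).
rewrite det_mulmx det_reflection mulrN1; case: (det_tile tg) => ->; lra.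
Qed.

Definition is_edge g k h j : bool := ((h == g) || (h == g *m r k)) && (j == k).

Lemma beyond_own g i : tile g -> beyond g i g = false.
Proof.
move=> tg; rewrite /beyond mink_tile //; apply/negbTE.
by rewrite -leNgt ltW // mink_normal_center.
Qed.

Lemma is_edge_same_wall g k h j : is_edge g k h j -> same_wall g k h j.
Proof.
case/andP => /orP[] /eqP -> /eqP ->; rewrite /same_wall ?eqxx //.
by rewrite -mulmxA reflection_normal_self mulmxN eqxx orbT.
Qed.

Lemma beyond_nonadj g k h : tile g -> tile h ->
  beyond g k h -> beyond g (k + 2) h -> False.
Proof.
move=> tg th; have [h' [th' hh' _]] := tile_inv th.
have -> : g = h *m (h' *m g) by rewrite mulmxA hh' mul1mx.
rewrite -{2}[h]mulmx1 -{4}[h]mulmx1 !beyond_mul // /beyond mul1mx => b1 b2.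
exact: (tile_nonadj (i := k) (tile_mul th' tg)).
Qed.

Lemma side_adj_succ k : side_adj k (k + 1).
Proof. by rewrite /side_adj eqxx. Qed.

Lemma side_adj_pred k : side_adj k (k - 1).
Proof. by rewrite /side_adj eqxx orbT. Qed.

(** If a side not adjacent to [k] separated [t] from the centre, then that side and side [k] of the
    mirror image [t *m r k] would both face the centre, against [tile_nonadj]. So no side of [t]
    does. *)
Lemma chamber_of_wall t k j : tile t -> same_wall t k 1%:M j ->
  mink (t *m n k) e < 0 -> mink (t *m n (k - 1)) e < 0 ->
  mink (t *m n (k + 1)) e < 0 -> t = 1%:M.
Proof.
move=> tt; rewrite /same_wall mul1mx => wl h0 hm hp.
have far i : k = i + 2 \/ i = k + 2 -> mink (t *m n i) e < 0.
  move=> ik; case: (ltgtP (mink (t *m n i) e) 0) => // [hi|/eqP]; last first.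
    by rewrite (negPf (mink_root_center i tt)).
  have E x : t *m r k *m x = r j *m (t *m x).
    rewrite -mulmxA !reflectionE mulmxBr -scalemxAr -/n -(mink_tile _ _ tt).
    by case/orP: wl => /eqP ->; rewrite ?minkNl ?mulrN ?scaleNr ?scalerN ?opprK.
  have k0 : 0 < mink (t *m r k *m n k) e.
    by rewrite -mulmxA reflection_normal_self mulmxN minkNl oppr_gt0.
  have ki : 0 < mink (t *m r k *m n i) e.
    rewrite E reflection_root_sign; last exact: root_tile.
    rewrite hi /=; apply/negP => w2.
    have /(same_wall_inj tt) : same_wall t k 1%:M j by rewrite /same_wall mul1mx.
    move=> /(_ i); rewrite /same_wall mul1mx => /(_ w2) ki.
    by move: ik; rewrite ki; move: i {hi w2 ki}; elim/ord5_ind; case.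
  have tr := tile_mul tt (tile_reflection R k).
  by case: ik => ik; [case: (@tile_nonadj R _ i tr)|case: (@tile_nonadj R _ k tr)]; rewrite -ik.
apply: tile_fundamental => // i.
have : [|| i == k, i == k - 1, i == k + 1, k == i + 2 | i == k + 2].
  by move: i k {wl h0 hm hp far}; elim/ord5_ind; elim/ord5_ind.
by case/or4P => [/eqP ->|/eqP ->|/eqP ->|/orP[/eqP ?|/eqP ?]] //; apply: far; [left|right].
Qed.

(** A side is the part of its line between the lines of its two neighbours. No tile is beyond both
    of these, so the two excluded parts are disjoint and can be removed modulo 2. *)
Lemma is_edgeE g k h j : tile g -> tile h -> is_edge g k h j =
  same_wall g k h j (+) (same_wall g k h j && beyond g (k - 1) h)
                    (+) (same_wall g k h j && beyond g (k + 1) h).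
Proof.
move=> tg th; case wl: (same_wall g k h j) => /=; last first.
  by apply/negbTE/negP => /is_edge_same_wall; rewrite wl.
case: (boolP (is_edge g k h j)) => [/andP[/orP[] /eqP -> _]|ne].
- by rewrite !beyond_own.
- rewrite !(beyond_step _ _ tg tg) !beyond_own //=.
  have W i : same_wall g i g k -> i = k.
    by move=> wi; apply: (same_wall_inj tg wi); rewrite /same_wall eqxx.
  by do 2![case: (boolP (same_wall _ _ _ _)) => [/W|_]]; move=> //; move: k {W wl}; elim/ord5_ind.
have nb : ~~ (beyond g (k - 1) h && beyond g (k + 1) h).
  apply/negP => /andP[b1]; rewrite (_ : k + 1 = k - 1 + 2); last by ring.
  exact: beyond_nonadj.
have [h' [th' hh' h'h]] := tile_inv th.
have gE : g = h *m (h' *m g) by rewrite mulmxA hh' mul1mx.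
have tt := tile_mul th' tg.
suff : ~~ (~~ beyond g (k - 1) h && ~~ beyond g (k + 1) h).
  by move: nb; do 2!case: beyond.
apply: contra ne => /andP[]; move: gE tt; set t := h' *m g => gE tt.
have bE i : beyond g i h = (0 < mink (t *m n i) e).
  by rewrite /beyond gE -mulmxA mink_tile.
rewrite !bE -!leNgt.
rewrite !le_eqVlt !(negPf (mink_root_center _ tt)) /= => bm bp.
have wt : same_wall t k 1%:M j.
  move: wl; rewrite /same_wall gE -!mulmxA -mulmxN mul1mx.
  by case/orP => /eqP/(tile_mulI th) ->; rewrite eqxx ?orbT.
have jk s : s = 1%:M \/ s = r k -> t = s -> j == k.
  move=> sE tE; move: wt; rewrite /same_wall tE mul1mx.
  case: sE => ->; rewrite ?mul1mx ?reflection_normal_self ?opprK => /orP[] /eqP E;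
   apply/eqP/normal_neq; by [left|right].
(* If [h] and [g] are on the same side of the line they coincide; otherwise [h] is the mirror image
   of [g]. *)
have := mink_root_center k tt; case: ltgtP => // tk _.
  have t1 := chamber_of_wall tt wt tk bm bp.
  by rewrite /is_edge gE t1 mulmx1 eqxx (jk _ _ t1) //; left.
have tr : t *m r k = 1%:M.
  have ap := side_adj_succ k; have am := side_adj_pred k.
  apply: (@chamber_of_wall _ k j); first exact: tile_mul tt (tile_reflection R k).
  - by rewrite same_wall_self.
  - by rewrite -mulmxA reflection_normal_self mulmxN minkNl oppr_lt0.
  - by rewrite -mulmxA reflection_normal_adj.
  - by rewrite -mulmxA reflection_normal_adj.
have tE : t = r k by rewrite -[t]mulmx1 -(reflection_sqr R k) mulmxA tr mul1mx.
rewrite /is_edge gE tE -mulmxA reflection_sqr mulmx1 eqxx orbT (jk _ _ tE) //.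
by right.
Qed.
End Walls.

(** * Chains of sides modulo boundaries of sets of tiles *)

Section Chains.
Variable R : realType.
Implicit Types (g h t : 'M[R]_3) (i j k a : 'I_5) (d : side R).
Implicit Types (f : 'M[R]_3 -> 'I_5 -> bool).

Let r := reflection R.

(* A chain tells which sides (h, j) are counted modulo 2; a coboundary is the
   boundary of a set A of tiles. *)
Definition coboundary f := exists A : 'M[R]_3 -> bool,
  forall h j, tile h -> f h j = A h (+) A (h *m r j).

Lemma coboundary_ext f f' : (forall h j, tile h -> f h j = f' h j) ->
  coboundary f -> coboundary f'.
Proof. by move=> ff [A fA]; exists A => h j th; rewrite -ff ?fA. Qed.

Lemma coboundaryD f f' : coboundary f -> coboundary f' ->
  coboundary (fun h j => f h j (+) f' h j).
Proof.
move=> [A fA] [B fB]; exists (fun h => A h (+) B h) => h j th.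
by rewrite fA // fB // addbACA.
Qed.

Definition cohomologous f f' := coboundary (fun h j => f h j (+) f' h j).

Lemma cohomologous_refl f f' : (forall h j, tile h -> f h j = f' h j) ->
  cohomologous f f'.
Proof. by move=> ff; exists (fun=> false) => h j th; rewrite ff ?addbb. Qed.

Lemma cohomologous_trans f' f f'' :
  cohomologous f f' -> cohomologous f' f'' -> cohomologous f f''.
Proof.
move=> c c'; apply: coboundary_ext (coboundaryD c c') => h j _.
by rewrite addbA addbK.
Qed.

Lemma cohomologousD f1 f1' f2 f2' : cohomologous f1 f1' -> cohomologous f2 f2' ->
  cohomologous (fun h j => f1 h j (+) f2 h j) (fun h j => f1' h j (+) f2' h j).
Proof.
move=> c c'; apply: coboundary_ext (coboundaryD c c') => h j _.
by rewrite addbACA.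
Qed.

(* The part beyond side a of the line of side k, i.e. the half-line starting at
   the vertex of g between sides k and a. *)
Definition ray g k a h j : bool := same_wall g k h j && beyond g a h.

Lemma side_adj_neq k a : side_adj k a -> k <> a.
Proof. by move=> + E; rewrite E; move: a {E}; elim/ord5_ind. Qed.

(** The difference of the two half-lines is the boundary of the quadrant that they enclose. *)
Lemma ray_swap g k a : tile g -> side_adj k a ->
  cohomologous (ray g k a) (ray g a k).
Proof.
move=> tg ka; exists (fun h => beyond g k h && beyond g a h) => h j th.
rewrite /ray !beyond_step //.
have : ~~ (same_wall g k h j && same_wall g a h j).
  by apply/negP => /andP[w1 w2]; case: (side_adj_neq ka); apply: (same_wall_inj tg w1 w2).
by do 4!case: (_ g _ h _) || case: (_ g _ h).
Qed.

Lemma ray_cross g k a : side_adj k a -> ray (g *m r k) k a =2 ray g k a.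
Proof. by move=> ka h j; rewrite /ray same_wall_self beyond_adj. Qed.

(** The whole line bounds a half-plane, so a side is equivalent to the rest of its line. *)
Lemma is_edge_rays g k : tile g ->
  cohomologous (is_edge g k)
    (fun h j => ray g k (k + 1) h j (+) ray g k (k - 1) h j).
Proof.
move=> tg; exists (beyond g k) => h j th.
rewrite is_edgeE // beyond_step // /ray.
by case: same_wall; case: beyond; case: beyond; case: beyond.
Qed.

Definition next_label g k := if \det g == 1 then k + 1 else k - 1.
Definition prev_label g k := if \det g == 1 then k - 1 else k + 1.

Lemma next_label_adj g k : side_adj k (next_label g k).
Proof. by rewrite /next_label; case: ifP => _; rewrite ?side_adj_succ ?side_adj_pred. Qed.

Lemma prev_label_adj g k : side_adj k (prev_label g k).
Proof. by rewrite /prev_label; case: ifP => _; rewrite ?side_adj_succ ?side_adj_pred. Qed.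

Lemma det_cross g k : tile g -> (\det (g *m r k) == 1) = ~~ (\det g == 1).
Proof.
move=> tg; rewrite det_mulmx det_reflection mulrN1.
have h : (- 1 == 1 :> R) = false by apply/eqP; lra.
by case: (det_tile tg) => ->; rewrite ?opprK eqxx h.
Qed.

Lemma next_label_cross g k : tile g -> next_label (g *m r k) k = prev_label g k.
Proof. by move=> tg; rewrite /next_label det_cross // if_neg. Qed.

Lemma prev_label_next g k : prev_label g (next_label g k) = k.
Proof. by rewrite /prev_label /next_label; case: (\det g == 1); rewrite ?addrK ?subrK. Qed.

(** Modulo coboundaries these rays stand for the vertex where they start: the initial vertex of [d]
    here, its end vertex for [end_ray]. *)
Definition start_ray d := ray d.1 d.2 (prev_label d.1 d.2).
Definition end_ray d := ray d.1 d.2 (next_label d.1 d.2).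

Lemma is_edge_start_end d : tile d.1 ->
  cohomologous (is_edge d.1 d.2)
    (fun h j => start_ray d h j (+) end_ray d h j).
Proof.
move=> td; apply: cohomologous_trans (is_edge_rays d.2 td) _.
apply: cohomologous_refl => h j _; rewrite /start_ray /end_ray.
by rewrite /next_label /prev_label; case: ifP => // _; rewrite addbC.
Qed.

Lemma start_ray_turn d : tile d.1 -> cohomologous (start_ray (turn d)) (end_ray d).
Proof.
move=> td; rewrite /start_ray /= -/(next_label d.1 d.2) prev_label_next.
by apply: ray_swap => //; rewrite side_adjC next_label_adj.
Qed.

Lemma tile_cross d : tile d.1 -> tile (cross d).1.
Proof. by move=> td; apply: tile_mul td (tile_reflection _ _). Qed.

(** Seen from the neighbouring tile, a side is traversed backwards. *)
Lemma end_ray_cross d : tile d.1 -> end_ray (cross d) =2 start_ray d.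
Proof.
move=> td h j; rewrite /end_ray /start_ray /= next_label_cross //.
by rewrite ray_cross // prev_label_adj.
Qed.

Definition sweep d m := iter m (fun s => turn (cross s)) (turn d).

Lemma tile_sweep d m : tile d.1 -> tile (sweep d m).1.
Proof. by move=> td; elim: m => //= m; apply: tile_cross. Qed.

Lemma start_ray_sweep d m : tile d.1 ->
  cohomologous (start_ray (sweep d m)) (end_ray d).
Proof.
move=> td; elim: m => [|m IH]; first exact: start_ray_turn.
apply: cohomologous_trans IH.
have ts := tile_sweep m td.
apply: cohomologous_trans (start_ray_turn (tile_cross ts)) _.
by apply: cohomologous_refl => h j _; rewrite end_ray_cross.
Qed.

(* The flag (g, k, a) is a strand on side k of tile g, running along the line
   of the adjacent side a; it leaves g through the other side adjacent to a. *)
Definition flag := ('M[R]_3 * 'I_5 * 'I_5)%type.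
Implicit Type x : flag.

(** For [k] adjacent to [a], the label [a + a - k] is the other neighbour of [a]. *)
Definition pass x : flag := (x.1.1, x.2 + x.2 - x.1.2, x.2).
Definition jump x : flag := (x.1.1 *m r x.1.2, x.1.2, x.2).
Definition advance x := jump (pass x).
Definition run x q := iter q advance x.
Definition flag_ray x := ray x.1.1 x.1.2 x.2.
Definition flag_adj x := side_adj x.1.2 x.2.

Lemma passK : involutive pass.
Proof. by case=> [[g k] a]; rewrite /pass /=; congr (_, _, _); ring. Qed.

Lemma jumpK : involutive jump.
Proof. by case=> [[g k] a]; rewrite /jump /= -mulmxA reflection_sqr mulmx1. Qed.

Lemma flag_adj_pass x : flag_adj (pass x) = flag_adj x.
Proof.
case: x => [[g k] a]; rewrite /flag_adj /=.
by move: k a; elim/ord5_ind; elim/ord5_ind.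
Qed.

Lemma flag_adj_run x q : flag_adj (run x q) = flag_adj x.
Proof. by elim: q => //= q <-; rewrite -[RHS]flag_adj_pass. Qed.

Lemma run_label x q : (run x q).2 = x.2.
Proof. by elim: q => //= q <-. Qed.

Lemma tile_run x q : tile x.1.1 -> tile (run x q).1.1.
Proof. by move=> tx; elim: q => //= q tq; apply: tile_mul tq (tile_reflection _ _). Qed.

Lemma is_edge_pass x : tile x.1.1 -> flag_adj x ->
  cohomologous (is_edge x.1.1 x.2)
    (fun h j => flag_ray x h j (+) flag_ray (pass x) h j).
Proof.
case: x => [[g k] a] /= tg; rewrite /flag_adj /= => ka.
apply: cohomologous_trans (is_edge_rays a tg) _.
have sw i : side_adj a i -> cohomologous (ray g a i) (ray g i a).
  exact: ray_swap.
have := cohomologousD (sw _ (side_adj_succ a)) (sw _ (side_adj_pred a)).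
move/cohomologous_trans; apply; apply: cohomologous_refl => h j _.
rewrite /flag_ray /=.
have [->|->] : k = a + 1 \/ k = a - 1.
  by move: ka; rewrite side_adjC => /orP[] /eqP; [left|right].
  by congr (_ (+) ray _ _ _ _ _); ring.
by rewrite addbC; congr (_ (+) ray _ _ _ _ _); ring.
Qed.

Lemma flag_ray_jump x : flag_adj x -> flag_ray (jump x) =2 flag_ray x.
Proof. by move=> ax h j; rewrite /flag_ray ray_cross. Qed.

(** The sum telescopes: consecutive tiles of the run share a vertex on the line, and only the first
    and last vertices survive. *)
Lemma run_edges x n : tile x.1.1 -> flag_adj x ->
  cohomologous (fun h j => \big[addb/false]_(q < n.+1) is_edge (run x q).1.1 x.2 h j)
    (fun h j => flag_ray x h j (+) flag_ray (pass (run x n)) h j).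
Proof.
move=> tx ax; elim: n => [|n IH].
  apply: cohomologous_trans (is_edge_pass tx ax).
  by apply: cohomologous_refl => h j _; rewrite big_ord1.
have tr := tile_run n.+1 tx; have ar : flag_adj (run x n.+1) by rewrite flag_adj_run.
have := cohomologousD IH (is_edge_pass tr ar).
rewrite run_label => c; apply: cohomologous_trans (cohomologous_trans _ c) _.
  by apply: cohomologous_refl => h j _; rewrite big_ord_recr.
apply: cohomologous_refl => h j _.
have -> : flag_ray (run x n.+1) h j = flag_ray (pass (run x n)) h j.
  by rewrite /run /= -/(run x n) flag_ray_jump // flag_adj_pass flag_adj_run.
by rewrite -addbA; congr (_ (+) _); rewrite addKb.
Qed.

Definition clockwise_flag x := x.2 == next_label x.1.1 x.1.2.

Lemma clockwise_flagP x : flag_adj x ->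
  x.2 = if clockwise_flag x then next_label x.1.1 x.1.2 else prev_label x.1.1 x.1.2.
Proof.
case: x => [[g k] a]; rewrite /flag_adj /clockwise_flag /= => /orP ka.
case: eqP => // ne; rewrite /next_label /prev_label in ne *.
by case: ka ne => /eqP ->; case: ifP.
Qed.

Lemma clockwise_flag_ray x : flag_adj x -> flag_ray x =
  if clockwise_flag x then end_ray x.1 else start_ray x.1.
Proof.
by move=> /clockwise_flagP; rewrite /flag_ray => ->; case: ifP.
Qed.

Lemma succ_neq_pred k : (k + 1 == k - 1) = false.
Proof. by move: k; elim/ord5_ind. Qed.

Lemma clockwise_pass x : flag_adj x -> clockwise_flag (pass x) = ~~ clockwise_flag x.
Proof.
case: x => [[g k] a]; rewrite /flag_adj /clockwise_flag /next_label /=.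
by case: ifP => _; move: k a; elim/ord5_ind; elim/ord5_ind.
Qed.

Lemma clockwise_jump x : tile x.1.1 -> flag_adj x ->
  clockwise_flag (jump x) = ~~ clockwise_flag x.
Proof.
case: x => [[g k] a] /= tg; rewrite /flag_adj /clockwise_flag /=.
rewrite next_label_cross // /next_label /prev_label.
by case: ifP => _; move: k a; elim/ord5_ind; elim/ord5_ind.
Qed.

(** Both [pass] and [jump] reverse the orientation of a flag. *)
Lemma clockwise_run x q : tile x.1.1 -> flag_adj x ->
  clockwise_flag (run x q) = clockwise_flag x.
Proof.
move=> tx ax; elim: q => //= q <-.
have ar : flag_adj (run x q) by rewrite flag_adj_run.
rewrite clockwise_jump ?flag_adj_pass ?clockwise_pass ?negbK //.
exact: tile_run q tx.
Qed.

Lemma flag_eq x y : flag_adj x -> flag_adj y -> x.1.1 = y.1.1 -> x.2 = y.2 ->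
  clockwise_flag x = clockwise_flag y -> x = y.
Proof.
move=> ax ay e1 e2 e3; case: x y ax ay e1 e2 e3 => [[g k] a] [[g' k'] a'] /=.
rewrite /flag_adj /clockwise_flag /next_label /= => + + gE aE; rewrite -gE -aE.
move=> ka ka' e; congr (_, _, _).
by case: ifP e => _; move: k k' a {aE gE} ka ka'; elim/ord5_ind; elim/ord5_ind; elim/ord5_ind.
Qed.
End Chains.

(** * Rows of tiles along a line *)

Lemma big_addb_eq (I : finType) (T : eqType) (t : I -> T) (h : T) : injective t ->
  \big[addb/false]_i (h == t i) = [exists i, h == t i].
Proof.
move=> ti; case: existsP => [[i /eqP ->]|nex]; last first.
  by apply: big1 => i _; apply/negbTE/negP => hi; apply: nex; exists i.
rewrite (bigD1 i) //= eqxx big1 // => j ji.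
by apply/negbTE; apply: contra ji => /eqP/ti ->.
Qed.

Lemma iter_inj (T : Type) (f : T -> T) m : injective f -> injective (iter m f).
Proof. by move=> fi; elim: m => //= m IH u v /fi/IH. Qed.

Section Runs.
Variables (R : realType) (P : {fset 'M[R]_3}).
Hypothesis tileP : forall g, g \in P -> tile g.
Implicit Types (g h t : 'M[R]_3) (i j k a : 'I_5) (x y : flag R).

Let r := reflection R.

Definition boundary_flag x : Prop :=
  [/\ x.1.1 \in P, flag_adj x & (jump x).1.1 \notin P].

(** That the run leaves the patch at [y] is expressed separately, by [boundary_flag y]. *)
Definition linked_by n x y : Prop :=
  (forall q, (q <= n)%N -> (run x q).1.1 \in P) /\ y = pass (run x n).

Definition linked x y : Prop := exists n, linked_by n x y.

Lemma advance_inj : injective (@advance R).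
Proof. exact: inj_comp (can_inj (@jumpK R)) (can_inj (@passK R)). Qed.

(* A repetition would let the run enter its first tile through a side that is on
   the boundary. *)
Lemma run_tile_inj x m : boundary_flag x ->
  (forall q, (q <= m)%N -> (run x q).1.1 \in P) ->
  forall p q, (p < q <= m)%N -> (run x p).1.1 <> (run x q).1.1.
Proof.
move=> [xP ax bx] inP p q /andP[pq qm] E.
have tx := tileP xP.
have : run x p = run x q.
  by apply: flag_eq; rewrite ?flag_adj_run ?run_label // !clockwise_run.
rewrite -(subnKC pq) addSnnS /run iterD => /(iter_inj advance_inj) /=.
set z := iter _ _ _ => /(congr1 (@jump R)); rewrite /advance jumpK => jx.
have : (jump x).1.1 \in P by rewrite jx; apply: inP; lia.
by rewrite (negPf bx).
Qed.

Lemma linked_exists x : boundary_flag x -> exists y, boundary_flag y /\ linked x y.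
Proof.
move=> bx; have [xP ax _] := bx.
have exn : exists q, (run x q).1.1 \notin P.
  apply: contrapT => /forallNP all_in.
  have inP q : (run x q).1.1 \in P by apply: contrapT => /negP; apply: all_in.
  (* One index more than there are tiles, so that an injection is impossible. *)
  pose f (q : 'I_#|{: P}|.+1) : P := [` inP q]%fset.
  have finj : injective f.
    move=> p q /(congr1 val) /= E; apply: val_inj => /=.
    have H u v : (u < v)%N -> (run x u).1.1 <> (run x v).1.1.
      by move=> uv; apply: (@run_tile_inj x v bx) => //; rewrite uv leqnn.
    by case: (ltngtP p q) => // /H; rewrite E.
  by have := leq_card f finj; rewrite card_ord ltnn.
case: (ex_minnP exn) => [[|n] out min]; first by rewrite xP in out.
have inP q : (q <= n)%N -> (run x q).1.1 \in P.
  by move=> qn; apply: contraT => /min; rewrite ltnNge qn.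
exists (pass (run x n)); split; last by exists n.
by split => //; [exact: inP|rewrite flag_adj_pass flag_adj_run].
Qed.

(** The shorter of two runs of unequal lengths would leave the patch where the longer one is still
    inside. *)
Lemma linked_unique x y y' : boundary_flag y -> boundary_flag y' ->
  linked x y -> linked x y' -> y = y'.
Proof.
move=> [_ _ by1] [_ _ by2] [n [inn yE]] [n' [inn' yE']].
have [nn|nn|nn] := ltngtP n n'.
- by move: by1; rewrite yE (inn' n.+1).
- by move: by2; rewrite yE' (inn n'.+1).
- by rewrite yE yE' nn.
Qed.

Lemma linked_sym x y : linked x y -> linked y x.
Proof.
move=> [n [inn yE]].
have rev q : (q <= n)%N -> run y q = pass (run x (n - q)).
  elim: q => [|q IH] qn; first by rewrite subn0.
  rewrite /run iterS -/(run y q) IH; last exact: ltnW.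
  have -> : (n - q = (n - q.+1).+1)%N by lia.
  by rewrite /run iterS /advance passK jumpK.
exists n; split; last by rewrite rev // subnn passK.
by move=> q qn; rewrite rev //=; apply: inn; rewrite leq_subr.
Qed.

Lemma linked_clockwise x y : boundary_flag x -> linked x y ->
  clockwise_flag y = ~~ clockwise_flag x.
Proof.
move=> [/tileP tx ax _] [n [_ ->]].
by rewrite clockwise_pass ?flag_adj_run // clockwise_run.
Qed.

Lemma linked_label x y : linked x y -> y.2 = x.2.
Proof. by move=> [n [_ ->]]; rewrite /= run_label. Qed.

Section OneRun.
Variables (n : nat) (x y : flag R).
Hypotheses (bx : boundary_flag x) (by_ : boundary_flag y) (xy : linked_by n x y).

Let a := x.2.

Definition on_run h : bool := [exists q : 'I_n.+1, h == (run x q).1.1].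

Lemma on_runP h : reflect (exists2 q, (q <= n)%N & h = (run x q).1.1) (on_run h).
Proof.
apply: (iffP existsP) => [[q /eqP ->]|[q qn ->]]; first by exists q => //; rewrite -ltnS.
by exists (Ordinal (qn : q < n.+1)%N).
Qed.

Lemma on_run_in h : on_run h -> h \in P.
Proof. by move=> /on_runP[q qn ->]; apply: (proj1 xy). Qed.

Lemma run_ord_inj : injective (fun q : 'I_n.+1 => (run x q).1.1).
Proof.
move=> p q E; apply: val_inj => /=.
have H (u v : 'I_n.+1) : (u < v)%N -> (run x u).1.1 <> (run x v).1.1.
  move=> uv; apply: (@run_tile_inj x n bx) => [|]; first exact: (proj1 xy).
  by rewrite uv -ltnS ltn_ord.
by case: (ltngtP p q) => // /H; rewrite E.
Qed.

(** An edge along the line is counted once for each of its two tiles that belongs to the row. *)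
Lemma sum_run_edges h j : tile h ->
  \big[addb/false]_(q < n.+1) is_edge (run x q).1.1 a h j =
  (j == a) && (on_run h (+) on_run (h *m r a)).
Proof.
move=> th; rewrite /on_run -!(big_addb_eq _ run_ord_inj) -big_split /= big_distrr /=.
apply: eq_bigr => q _; rewrite /is_edge andbC; congr (_ && _).
have -> : (h == (run x q).1.1 *m reflection R a) = (h *m r a == (run x q).1.1).
  by apply/eqP/eqP => [->|<-]; rewrite -mulmxA reflection_sqr mulmx1.
case: eqP => [<-|_] //=.
by rewrite (negPf (tile_reflection_neq a th)).
Qed.

Lemma run_label_cases q k : side_adj k a ->
  k = (run x q).1.2 \/ k = (pass (run x q)).1.2.
Proof.
case: bx => _ ax _; have := flag_adj_run x q; rewrite ax /flag_adj /pass /= run_label -/a.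
move: (run x q).1.2 => l la ka.
suff : (k == l) || (k == a + a - l) by case/orP => /eqP; [left|right].
by move: k l a la ka; elim/ord5_ind; elim/ord5_ind; elim/ord5_ind.
Qed.

Lemma run_neighbor g k : on_run g -> side_adj k a ->
  [\/ on_run (g *m r k), (g, k, a) = x | (g, k, a) = y].
Proof.
move=> /on_runP[q qn gE] /(run_label_cases q)[kE|kE].
  case: q qn gE kE => [|q] qn gE kE; first constructor 2.
    by rewrite gE kE /run /= /a; case: (x) => [[]].
  constructor 1; apply/on_runP; exists q; first exact: ltnW.
  by rewrite gE kE /= -mulmxA reflection_sqr mulmx1.
move: qn; rewrite leq_eqVlt => /orP[/eqP qn|qn].
  constructor 3; rewrite (proj2 xy) gE kE qn /pass /= !run_label.
  by [].
by constructor 1; apply/on_runP; exists q.+1 => //; rewrite gE kE.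
Qed.

Lemma on_run_step g k : side_adj k a -> g \in P -> g *m r k \in P ->
  on_run (g *m r k) = on_run g.
Proof.
have step g' : side_adj k a -> g' *m r k \in P -> on_run g' -> on_run (g' *m r k).
  move=> ka gkP /run_neighbor /(_ ka)[//|E|E].
    by case: bx => _ _; rewrite -E /jump /= gkP.
  by case: by_ => _ _; rewrite -E /jump /= gkP.
move=> ka gP gkP; apply/idP/idP; last exact: step.
move=> /(step _ ka); rewrite -mulmxA reflection_sqr mulmx1; exact.
Qed.

Lemma on_run_end g k : on_run g -> side_adj k a -> g *m r k \notin P ->
  (g, k, a) = x \/ (g, k, a) = y.
Proof.
move=> og ka; case: (run_neighbor og ka) => [/on_run_in ->//|->|->]; first by left.
by right.
Qed.

Lemma on_run_source : on_run x.1.1.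
Proof. by apply/on_runP; exists 0%N. Qed.

Lemma on_run_target : on_run y.1.1.
Proof. by apply/on_runP; exists n; rewrite // (proj2 xy). Qed.

Variable A : 'M[R]_3 -> bool.
Hypothesis A_step : forall h j, h \in P -> h *m r j \in P ->
  A h (+) A (h *m r j) = (j == a) && (on_run h (+) on_run (h *m r a)).

(* The side of the row on which the corner of g between sides k and k' lies, up
   to a global constant; it depends only on the vertex of the patch. *)
Definition corner_color g k k' := A g (+) (on_run g && ((k == a) || (k' == a))).

Definition start_color (d : side R) := corner_color d.1 d.2 (prev_label d.1 d.2).
Definition end_color (d : side R) := corner_color d.1 d.2 (next_label d.1 d.2).

Lemma start_color_turn d : start_color (turn d) = end_color d.
Proof.
rewrite /start_color /end_color /corner_color /= -/(next_label d.1 d.2) prev_label_next.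
by rewrite [(_ == a) || _]orbC.
Qed.

(** Across a side labelled [a], the change of [A] makes up for that of [on_run]. Across any other
    side [A] is constant, and [on_run] matters only if the side is adjacent to [a], where it is
    constant too. *)
Lemma end_color_cross d : d.1 \in P -> (cross d).1 \in P ->
  end_color (cross d) = start_color d.
Proof.
case: d => g k /= gP gkP; rewrite /start_color /end_color /corner_color /=.
rewrite next_label_cross; last exact: tileP.
have := A_step gP gkP; have [->|ka] := eqVneq k a => /=.
  rewrite !andbT -/r; do 2!case: (A _); do 2!case: on_run; by [].
move=> AA; have -> : A (g *m reflection R k) = A g.
  by move: AA; rewrite -/(r k); do 2!case: (A _).
congr (_ (+) _).
case: eqP => pa; last by rewrite !andbF.
by rewrite !andbT on_run_step // -pa prev_label_adj.
Qed.

Lemma start_color_sweep d m : d.1 \in P ->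
  (forall q, (q < m)%N -> (cross (sweep d q)).1 \in P) ->
  (sweep d m).1 \in P /\ start_color (sweep d m) = end_color d.
Proof.
move=> dP; elim: m => [|m IH] sP; first by split => //; apply: start_color_turn.
have [mP <-] := IH (fun q qm => sP q (leqW qm)).
split; first exact: sP.
by rewrite /sweep /= start_color_turn end_color_cross //; apply: sP.
Qed.
End OneRun.
End Runs.

(** * Vertices and edges around the boundary of the patch *)

Section Boundary.
Variables (R : realType) (P : {fset 'M[R]_3}) (N : nat) (bd : N.-tuple (P * 'I_5)).
Hypothesis tileP : forall g, g \in P -> tile g.
Hypothesis bdP : clockwise_boundary bd.
Implicit Types (g h : 'M[R]_3) (i j l : 'I_N) (k a : 'I_5) (x y : flag R).

Let r := reflection R.

Definition bd_side l : side R := patch_side (tnth bd l).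

Lemma bd_side_in l : (bd_side l).1 \in P.
Proof. exact: valP. Qed.

Lemma bd_side_out l : (cross (bd_side l)).1 \notin P.
Proof. by case: bdP => _ /(_ (tnth bd l)) [+ _] _; apply; apply: mem_tnth. Qed.

Lemma patch_side_inj : injective (@patch_side R P).
Proof. by move=> [g k] [g' k'] [/val_inj -> ->]. Qed.

Lemma bd_side_inj : injective bd_side.
Proof. by move=> l l' /patch_side_inj; case: bdP => /tuple_uniqP h _ _ /h. Qed.

Lemma bd_side_surj g k : g \in P -> g *m r k \notin P -> exists l, bd_side l = (g, k).
Proof.
move=> gP gk; case: bdP => _ /(_ ([` gP]%fset, k)) [_ /(_ gk)] + _.
by move=> /tnthP[l E]; exists l; rewrite /bd_side -E.
Qed.

Lemma bd_sweep l l' : l' = l.+1 :> nat -> exists m,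
  [/\ bd_side l' = sweep (bd_side l) m &
   forall q, (q < m)%N -> (cross (sweep (bd_side l) q)).1 \in P].
Proof.
move=> ll'; case: bdP => _ _ /(_ l l').
(* Here [l.+1 < N], so the cyclic successor does not wrap around. *)
rewrite -ll' modn_small // => /(_ erefl)[m [E _ H]].
by exists m.
Qed.

Definition prefix_edges m h k : bool :=
  \big[addb/false]_(l : 'I_N | (l < m)%N) is_edge (bd_side l).1 (bd_side l).2 h k.

Lemma prefix_edgesS l h k : prefix_edges l.+1 h k =
  prefix_edges l h k (+) is_edge (bd_side l).1 (bd_side l).2 h k.
Proof.
rewrite /prefix_edges (bigD1 l) //= addbC; congr (_ (+) _).
by apply: eq_bigl => q; rewrite ltnS leq_eqVlt -val_eqE; case: ltngtP.
Qed.

Lemma prefix_edges_internal m h k : h \in P -> h *m r k \in P -> prefix_edges m h k = false.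
Proof.
move=> hP hk; apply: big1 => l _; apply/negbTE; apply/negP => /andP[/orP[] /eqP E /eqP kE].
  by have := bd_side_out l; rewrite /cross -E -kE /= hk.
suff : (cross (bd_side l)).1 \in P by rewrite (negPf (bd_side_out l)).
by rewrite /cross -E.
Qed.

Lemma tile_bd l : tile (bd_side l).1.
Proof. exact: tileP (bd_side_in l). Qed.

(** Induction along the boundary: each side adds its own edge and ends at the initial vertex of the
    next side. *)
Lemma start_ray_bd (l0 : 'I_N) : l0 = 0%N :> nat -> forall l,
  cohomologous (start_ray (bd_side l))
    (fun h k => start_ray (bd_side l0) h k (+) prefix_edges l h k).
Proof.
move=> l00 [m]; elim: m => [|m IH] lt_mN.
  rewrite (_ : Ordinal lt_mN = l0); last exact: val_inj.
  apply: cohomologous_refl => h k _.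
  by rewrite /prefix_edges big_pred0 ?addbF // => q; rewrite l00.
pose l := Ordinal (ltnW lt_mN).
have [q [-> _]] := @bd_sweep l (Ordinal lt_mN) erefl.
apply: cohomologous_trans (start_ray_sweep q (tile_bd l)) _.
apply: coboundary_ext (coboundaryD (IH (ltnW lt_mN)) (is_edge_start_end (tile_bd l))).
move=> h k _; rewrite -/l [prefix_edges (Ordinal lt_mN) h k](prefix_edgesS l).
by case: start_ray; case: start_ray; case: end_ray; case: prefix_edges; case: is_edge.
Qed.

Lemma end_ray_bd (l0 : 'I_N) : l0 = 0%N :> nat -> forall l,
  cohomologous (end_ray (bd_side l))
    (fun h k => start_ray (bd_side l0) h k (+) prefix_edges l.+1 h k).
Proof.
move=> l00 l.
apply: coboundary_ext (coboundaryD (start_ray_bd l00 l) (is_edge_start_end (tile_bd l))).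
move=> h k _; rewrite prefix_edgesS.
by case: start_ray; case: start_ray; case: end_ray; case: prefix_edges; case: is_edge.
Qed.

Lemma next_label_neq_prev g k : next_label g k <> prev_label g k.
Proof.
rewrite /next_label /prev_label; case: (_ == 1); move/eqP; last rewrite eq_sym.
  by rewrite succ_neq_pred.
by rewrite succ_neq_pred.
Qed.

Section OneDimer.
Variables (n : nat) (x y : flag R) (i j : 'I_N).
Hypotheses (bx : boundary_flag P x) (by_ : boundary_flag P y).
Hypothesis xy : linked_by P n x y.
Hypotheses (cx : clockwise_flag x) (cy : ~~ clockwise_flag y).
Hypotheses (xi : x.1 = bd_side i) (yj : y.1 = bd_side j).

Let a := x.2.
Let on_run := on_run n x.

(** The vertex of [x] is the end of side [i], that of [y] the start of side [j]. The line-side edges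
    of the row, closed up by the boundary prefixes back to the pivot, form a coboundary; across
    internal sides only the edges of the row are seen. *)
Lemma run_potential : exists A : 'M[R]_3 -> bool,
  forall h k, h \in P -> h *m r k \in P ->
    A h (+) A (h *m r k) = (k == a) && (on_run h (+) on_run (h *m r a)).
Proof.
have [xP ax _] := bx; have [yP ay _] := by_.
have tx := tileP xP.
pose l0 : 'I_N := Ordinal (leq_ltn_trans (leq0n i) (ltn_ord i)).
have e := run_edges n tx ax.
rewrite -(proj2 xy) !clockwise_flag_ray // cx (negPf cy) xi yj in e.
have [A AE] := coboundaryD e
   (coboundaryD (@end_ray_bd l0 erefl i) (@start_ray_bd l0 erefl j)).
exists A => h k hP hk; have th := tileP hP.
rewrite -AE // !prefix_edges_internal // -(sum_run_edges tileP bx xy k th).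
rewrite -/a.
by case: (bigop _ _ _); case: start_ray; case: start_ray; case: end_ray.
Qed.

(** On boundary sides [D] differs from [end_color] only at [i] and from [start_color] only at [j].
    As colors agree at the vertex shared by consecutive sides, [D] switches just after [i] and on
    arrival at [j]. *)
Lemma boundary_color : exists A : 'M[R]_3 -> bool,
  let D g k := A g (+) ((k == a) && on_run g) in
  (forall g k, g \in P -> g *m r k \in P -> D (g *m r k) k = D g k) /\
  exists c, forall l, D (bd_side l).1 (bd_side l).2 = c (+) (l <= i)%N (+) (l < j)%N.
Proof.
have [A A_step] := run_potential; exists A => D; split.
  move=> g k gP gk; rewrite /D; have := A_step g k gP gk.
  case: eqP => [->|_] /=; last by do 2!case: (A _).
  by do 2!case: (A _); do 2!case: on_run.
have [xP ax _] := bx; have [yP ay _] := by_.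
have ya : y.2 = a by apply: (@linked_label _ P); exists n.
have xa : a = next_label (bd_side i).1 (bd_side i).2.
  by move: cx; rewrite /clockwise_flag xi => /eqP.
have yb : a = prev_label (bd_side j).1 (bd_side j).2.
  by move: (clockwise_flagP ay); rewrite (negPf cy) ya yj.
pose D' l := D (bd_side l).1 (bd_side l).2.
(* Two consecutive labels are not both [a], so the disjunction in [corner_color] is a sum modulo
   2. *)
have excl g k : ~~ ((k == a) && (next_label g k == a)) /\ ~~ ((k == a) && (prev_label g k == a)).
  split; apply/negP => /andP[/eqP -> /eqP E].
    by apply: (side_adj_neq (next_label_adj g a)).
  by apply: (side_adj_neq (prev_label_adj g a)).
have De l : D' l = end_color n x A (bd_side l) (+) (l == i).
  have [ex _] := excl (bd_side l).1 (bd_side l).2.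
  rewrite /D' /D /end_color /corner_color -/on_run -addbA; congr (_ (+) _).
  have -> : (l == i) = on_run (bd_side l).1 && (next_label (bd_side l).1 (bd_side l).2 == a).
    apply/eqP/andP => [->|[ol /eqP na]].
      by rewrite -xa eqxx -xi /on_run on_run_source.
    have ad : side_adj (bd_side l).2 a by rewrite -na next_label_adj.
    case: (on_run_end bx xy ol ad (bd_side_out l)) => E.
      by apply: bd_side_inj; rewrite -xi -E; case: (bd_side l).
    by move: cy; rewrite -E /clockwise_flag /= na eqxx.
  by rewrite -/a; move: ex; do 2!case: (_ == a) => //; case: on_run.
have Ds l : D' l = start_color n x A (bd_side l) (+) (l == j).
  have [_ ex] := excl (bd_side l).1 (bd_side l).2.
  rewrite /D' /D /start_color /corner_color -/on_run -addbA; congr (_ (+) _).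
  have -> : (l == j) = on_run (bd_side l).1 && (prev_label (bd_side l).1 (bd_side l).2 == a).
    apply/eqP/andP => [->|[ol /eqP na]].
      by rewrite -yb eqxx -yj /on_run (on_run_target xy).
    have ad : side_adj (bd_side l).2 a by rewrite -na prev_label_adj.
    case: (on_run_end bx xy ol ad (bd_side_out l)) => E.
      have := cx; rewrite -E /clockwise_flag /= -/a -na => /eqP.
      by move/esym/next_label_neq_prev.
    by apply: bd_side_inj; rewrite -yj -E; case: (bd_side l).
  by rewrite -/a; move: ex; do 2!case: (_ == a) => //; case: on_run.
pose l0 : 'I_N := Ordinal (leq_ltn_trans (leq0n i) (ltn_ord i)).
(* Fixed by the case [l = 0], where [l <= i] holds. *)
exists (D' l0 (+) true (+) (0 < j)%N) => -[m]; rewrite -/(D' _).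
elim: m => [|m IH] lt_mN.
  rewrite (_ : Ordinal lt_mN = l0); last exact: val_inj.
  by rewrite -/(D' _) leq0n /=; case: (D' _); case: (0 < j)%N.
pose l := Ordinal (ltnW lt_mN).
have [q [E H]] := @bd_sweep l (Ordinal lt_mN) erefl.
have [_ sE] := start_color_sweep tileP bx by_ xy A_step (bd_side_in l) H.
rewrite -/(D' (Ordinal lt_mN)) (Ds (Ordinal lt_mN)) E sE.
have := IH (ltnW lt_mN); rewrite -/l -/(D' l) (De l) => /(canRL (addbK _)) ->.
rewrite -!val_eqE /=.

have h1 : (m <= i)%N = (m < i)%N (+) (m == i) by case: (ltngtP m i).
have h2 : (m < j)%N = (m.+1 < j)%N (+) (m.+1 == j) by case: (ltngtP m.+1 j).
rewrite h1 h2.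
by do 2!case: (_ == _); do 2!case: (_ < _)%N; case: (D' _); case: (_ < _)%N.
Qed.
End OneDimer.
End Boundary.

(** * Parities of the values on the legs *)

Lemma parity_involution (T : finType) (s : T -> T) (Q : pred T) (F : T -> bool) :
  (forall d, Q d -> [/\ Q (s d), s (s d) = d, s d != d & F (s d) = F d]) ->
  \big[addb/false]_(d | Q d) F d = false.
Proof.
move=> H; rewrite (bigID (fun d => enum_rank d < enum_rank (s d))%N) /=.
(* Extended by the identity outside [Q], the involution becomes a bijection of the whole type, by
   which the sum can be reindexed. *)
pose s' d := if Q d then s d else d.
have s'E d : Q d -> s' d = s d by rewrite /s' => ->.
have s'K : involutive s'.
  move=> d; case Qd: (Q d); last by rewrite /s' !Qd.
  by have [Qs sK _ _] := H d Qd; rewrite !s'E.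
rewrite [X in X (+) _](reindex_inj (can_inj s'K)) /=.
rewrite (eq_big (fun d => Q d && ~~ (enum_rank d < enum_rank (s d))%N) F) ?addbb //.
  move=> d; case Qd: (Q d); last by rewrite /s' !Qd.
  have [Qs sK nd _] := H d Qd; rewrite s'E // sK Qs /= -leqNgt ltn_neqAle.
  by rewrite (inj_eq val_inj) (inj_eq enum_rank_inj) nd.
move=> d; case Qd: (Q d); last by rewrite /s' !Qd.
by have [_ _ _ Fs] := H d Qd; rewrite s'E.
Qed.

Lemma big_ord5 (T : Type) (idx : T) (op : Monoid.com_law idx) (F : 'I_5 -> T) a :
  \big[op/idx]_k F k =
  op (F a) (op (F (a + 1)) (op (F (a - 1)) (op (F (a + 2)) (F (a - 2))))).
Proof.
rewrite (bigD1 a) //= (bigD1 (a + 1)) /=; last by move: a; elim/ord5_ind.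
rewrite (bigD1 (a - 1)) /=; last by move: a; elim/ord5_ind.
rewrite (bigD1 (a + 2)) /=; last by move: a; elim/ord5_ind.
rewrite (bigD1 (a - 2)) /=; last by move: a; elim/ord5_ind.
rewrite big_pred0; last by move: a; elim/ord5_ind; elim/ord5_ind.
by rewrite Monoid.mulm1.
Qed.

Section LegSums.
Variables (R : realType) (P : {fset 'M[R]_3}) (N : nat) (bd : N.-tuple (P * 'I_5)).
Hypothesis tileP : forall g, g \in P -> tile g.
Hypothesis bdP : clockwise_boundary bd.
Implicit Types (g : P) (h : 'M[R]_3) (i j l : 'I_N) (k : 'I_5) (x y : flag R).
Implicit Types (d : P * 'I_5) (chi : P * 'I_5 -> bool).

Let r := reflection R.

(** The default [d] is returned if the neighbouring tile is outside [P], that is, on boundary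
    sides. *)
Definition partner d : P * 'I_5 :=
  if insub (val d.1 *m r d.2) is Some g then (g, d.2) else d.

Definition internal d := val d.1 *m r d.2 \in P.

Lemma partnerE d : internal d -> patch_side (partner d) = cross (patch_side d).
Proof. by rewrite /internal /partner => iP; rewrite insubT. Qed.

Lemma internal_partner d : internal d ->
  [/\ internal (partner d), partner (partner d) = d & partner d != d].
Proof.
move=> id; have pE := partnerE id.
have [p1 p2] : val (partner d).1 = val d.1 *m r d.2 /\ (partner d).2 = d.2.
  by move: pE; rewrite /cross /patch_side; case.
have ip : internal (partner d).
  by rewrite /internal p1 p2 -mulmxA reflection_sqr mulmx1; apply: valP.
split => //.
  apply: patch_side_inj; rewrite partnerE // pE /cross /patch_side /=.
  by rewrite -mulmxA reflection_sqr mulmx1.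
apply/eqP => pd; have := tile_reflection_neq d.2 (tileP (valP d.1)).
by rewrite -p1 pd eqxx.
Qed.

Definition matched chi := forall d e,
  patch_side e = cross (patch_side d) -> chi d = chi e.

(** The two names of an internal side carry the same value and cancel. *)
Lemma parity_internal chi : (forall d, internal d -> chi (partner d) = chi d) ->
  \big[addb/false]_d chi d = \big[addb/false]_l chi (tnth bd l).
Proof.
move=> m; rewrite (bigID internal) /=.
rewrite (@parity_involution _ partner); last first.
  by move=> d id; have [ip pp np] := internal_partner id; rewrite m.
rewrite /= -(big_tuple _ _ bd xpredT) /=; case: bdP => ubd bdE _; rewrite big_uniq //.
by apply: eq_bigl => d; apply/idP/idP => /bdE.
Qed.

Definition tile_parity chi g := \big[addb/false]_k chi (g, k).

Lemma parity_legs chi : \big[addb/false]_d chi d = \big[addb/false]_g tile_parity chi g.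
Proof. by rewrite /tile_parity pair_big; apply: eq_bigr => -[]. Qed.

Definition prefix_parity (z : 'I_N -> bool) m := \big[addb/false]_(l : 'I_N | (l < m)%N) z l.

Lemma prefix_parityS z i : prefix_parity z i.+1 = z i (+) prefix_parity z i.
Proof.
rewrite /prefix_parity (bigD1 i) //=; congr (_ (+) _).
by apply: eq_bigl => q; rewrite ltnS leq_eqVlt -val_eqE; case: ltngtP.
Qed.

Section OneDimer.
Variables (n : nat) (x y : flag R) (i j : 'I_N).
Hypotheses (bx : boundary_flag P x) (by_ : boundary_flag P y).
Hypothesis xy : linked_by P n x y.
Hypotheses (cx : clockwise_flag x) (cy : ~~ clockwise_flag y).
Hypotheses (xi : x.1 = bd_side bd i) (yj : y.1 = bd_side bd j).

Let a := x.2.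
Let on_run h := on_run n x h.

(** Over the tiles of the row, the values on the sides along the line; [far_parity] takes the two
    sides of each tile that are not adjacent to that side. *)
Definition near_parity chi := \big[addb/false]_g (on_run (val g) && chi (g, a)).
Definition far_parity chi := \big[addb/false]_g
  (on_run (val g) && (chi (g, a + 2) (+) chi (g, a - 2))).

(** The leg values weighted by [D] are summed over all sides: internal sides cancel, and boundary
    sides give two prefix parities and [c] times the total parity. This sum differs from the sum of
    tile parities weighted by [A] by [near_parity]. *)
Lemma near_parityE : exists e : (P -> bool) -> bool, forall chi, matched chi ->
  let z l := chi (tnth bd l) in
  near_parity chi =
    e (tile_parity chi) (+) prefix_parity z i.+1 (+) prefix_parity z j.
Proof.
have [A [D_int [c D_bd]]] := boundary_color tileP bdP bx by_ xy cx cy xi yj.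
exists (fun p => (\big[addb/false]_g (A (val g) && p g)) (+) (c && \big[addb/false]_g p g)).
move=> chi m z; have mp d : internal d -> chi (partner d) = chi d.
  by move=> id; rewrite (m d (partner d)) // partnerE.
pose D h k := A h (+) ((k == a) && on_run h).
have e1 : \big[addb/false]_g (A (val g) && tile_parity chi g) =
    \big[addb/false]_(d : P * 'I_5) (D (val d.1) d.2 && chi d) (+) near_parity chi.
  rewrite (parity_legs (fun d => D (val d.1) d.2 && chi d)) -big_split /=.
  apply: eq_bigr => g _; rewrite /tile_parity big_distrr /=.
  rewrite (bigD1 a) //= [in RHS](bigD1 a) //= /D eqxx.
  rewrite [in RHS](eq_bigr (fun k => A (val g) && chi (g, k))); last first.
    by move=> k /negbTE ->; rewrite addbF.
  by case: (A _); case: (on_run _); case: (chi _); case: (bigop _ _ _).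
have e2 : \big[addb/false]_(d : P * 'I_5) (D (val d.1) d.2 && chi d) =
    \big[addb/false]_(l : 'I_N) ((c (+) (l <= i)%N (+) (l < j)%N) && z l).
  rewrite parity_internal => [|d id]; last first.
    rewrite mp //; congr (_ && _).
    have := partnerE id; rewrite /cross /patch_side /= => -[-> ->].
    by apply: D_int; [exact: valP|exact: id].
  by apply: eq_bigr => l _; rewrite -D_bd.
have e3 : \big[addb/false]_g tile_parity chi g = \big[addb/false]_l z l.
  by rewrite -parity_legs parity_internal.
have e4 : \big[addb/false]_(l : 'I_N) ((c (+) (l <= i)%N (+) (l < j)%N) && z l) =
    (c && \big[addb/false]_l z l) (+) prefix_parity z i.+1 (+) prefix_parity z j.
  rewrite /prefix_parity big_distrr /= [X in _ (+) X (+) _]big_mkcond.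
  rewrite [X in _ (+) X]big_mkcond -!big_split /=; apply: eq_bigr => l _.
  by rewrite ltnS; case: c {D_bd e2}; case: (_ <= _)%N; case: (_ < _)%N; case: (z l).
rewrite e1 e2 e4 e3.
by case: (near_parity chi); case: (c && _); case: prefix_parity; case: prefix_parity.
Qed.

Lemma run_ends_neq : i != j.
Proof.
have [_ ax _] := bx; have [_ ay _] := by_.
have ya : y.2 = a by apply: (@linked_label _ P); exists n.
apply/eqP => ij; have := eqP cx; rewrite -/a -ya (clockwise_flagP ay) (negPf cy) yj xi ij.
by move/esym/next_label_neq_prev.
Qed.

Definition crossing_leg d := on_run (val d.1) && side_adj d.2 a.

Lemma crossing_leg_internal d : internal d -> crossing_leg (partner d) = crossing_leg d.
Proof.
move=> id; rewrite /crossing_leg; have := partnerE id; rewrite /cross /patch_side /= => -[-> ->].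
case ad: (side_adj d.2 a); rewrite ?andbF // !andbT.
exact: on_run_step bx by_ xy _ _ ad (valP d.1) id.
Qed.

Lemma crossing_leg_bd l : crossing_leg (tnth bd l) = (l == i) (+) (l == j).
Proof.
have [_ ax _] := bx; have [_ ay _] := by_.
have ya : y.2 = a by apply: (@linked_label _ P); exists n.
rewrite /crossing_leg -[val (tnth bd l).1]/((bd_side bd l).1) -[(tnth bd l).2]/((bd_side bd l).2).
have [->|li] := eqVneq l i.
  by rewrite (negPf run_ends_neq) /on_run -xi on_run_source; apply: ax.
have [->|lj] := eqVneq l j.
  by rewrite /on_run -yj (on_run_target xy) -ya; apply: ay.
apply/negbTE/negP => /andP[ol ad].
case: (on_run_end bx xy ol ad (bd_side_out bdP l)) => E.
  by case/eqP: li; apply: (bd_side_inj bdP); rewrite -xi -E; case: (bd_side bd l).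
by case/eqP: lj; apply: (bd_side_inj bdP); rewrite -yj -E; case: (bd_side bd l).
Qed.

Lemma crossing_leg_parity chi : matched chi ->
  \big[addb/false]_d (crossing_leg d && chi d) = chi (tnth bd i) (+) chi (tnth bd j).
Proof.
move=> m; rewrite parity_internal; last first.
  by move=> d id; rewrite crossing_leg_internal // (m d (partner d)) // partnerE.
rewrite (bigD1 i) //= (bigD1 j) /=; last by rewrite eq_sym run_ends_neq.
rewrite big1 ?addbF => [|l /andP[/negPf li /negPf lj]]; last by rewrite crossing_leg_bd li lj.
by rewrite !crossing_leg_bd !eqxx (negPf run_ends_neq) eq_sym (negPf run_ends_neq).
Qed.

Lemma far_parityE : exists e : (P -> bool) -> bool, forall chi, matched chi ->
  let z l := chi (tnth bd l) in
  far_parity chi =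
    e (tile_parity chi) (+) prefix_parity z i (+) prefix_parity z j (+) z j.
Proof.
have [e eP] := near_parityE.
exists (fun p => e p (+) \big[addb/false]_g (on_run (val g) && p g)) => chi m z.
(* Of the five legs of a tile in the row, one lies along the line, two are crossed by the row and
   two are far. *)
have E : far_parity chi =
    \big[addb/false]_g (on_run (val g) && tile_parity chi g) (+) near_parity chi
    (+) \big[addb/false]_d (crossing_leg d && chi d).
  rewrite (parity_legs (fun d => crossing_leg d && chi d)) -!big_split /=.
  apply: eq_bigr => g _; rewrite /crossing_leg /tile_parity /=.
  rewrite (big_ord5 _ _ a) [in RHS](big_ord5 _ _ a) /=.
  have [-> -> -> -> ->] : [/\ side_adj a a = false, side_adj (a + 1) a = true,
     side_adj (a - 1) a = true, side_adj (a + 2) a = false & side_adj (a - 2) a = false].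
    by move: a; elim/ord5_ind.
  case: (on_run _); case: (chi _); case: (chi _); case: (chi _);
  case: (chi _); by case: (chi _).
(* The value at [i] turns the prefix up to [i.+1] into the prefix up to [i]. *)
rewrite E (eP _ m) crossing_leg_parity // -/z prefix_parityS -/(z i) -/(z j).
case: (e _); case: (z i); case: (z j); case: prefix_parity; case: prefix_parity;
  by case: (bigop _ _ _).
Qed.
End OneDimer.
End LegSums.

(** * Code states *)

Definition bit (v : 'I_2) : bool := v == 1.

Lemma ord2_ind (Q : 'I_2 -> Prop) : Q 0 -> Q 1 -> forall v, Q v.
Proof.
move=> Q0 Q1 [[|[|//]] h].
- by rewrite (_ : Ordinal h = 0) //; apply: val_inj.
- by rewrite (_ : Ordinal h = 1) //; apply: val_inj.
Qed.

Lemma bitD v (c : bool) : bit (v + c%:R) = bit v (+) c.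
Proof. by move: v; elim/ord2_ind; case: c. Qed.

Lemma bit_inj : injective bit.
Proof. by elim/ord2_ind; elim/ord2_ind. Qed.

Lemma addKb2 v (c : bool) : v + c%:R + c%:R = v :> 'I_2.
Proof. by apply: bit_inj; rewrite !bitD addbK. Qed.

(** * Tensor products of monomial matrices *)

Section TensorOp.
Variables (R : realType) (L : nat).
Implicit Types (x y : config L) (psi : state R L) (A : 'I_L -> 'M[R[i]]_2).

Lemma tensor_op_monomial A (f : 'I_L -> bool) psi x :
  (forall k v, v != x k + (f k)%:R -> A k (x k) v = 0) ->
  tensor_op A psi x = (\prod_k A k (x k) (x k + (f k)%:R)) *
                      psi [ffun k => x k + (f k)%:R].
Proof.
move=> Af; rewrite ffunE [LHS](bigD1 [ffun k => x k + (f k)%:R]) //=.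
rewrite [X in _ + X]big1 => [|y ny].
  by rewrite addr0; congr (_ * _); apply: eq_bigr => k _; rewrite ffunE.
suff [k yk] : exists k, y k != x k + (f k)%:R by rewrite (bigD1 k) //= Af ?mul0r.
apply/existsP; rewrite -negb_forall; apply: contra ny => /forallP E.
by apply/eqP/ffunP => k; rewrite ffunE; apply/eqP.
Qed.

Lemma pauliXE v w : pauliX R v w = (w == v + true%:R)%:R.
Proof. by rewrite mxE; move: v w; elim/ord2_ind; elim/ord2_ind. Qed.

Lemma pauliYE v w : pauliY R v w = (w == v + true%:R)%:R * (- 'i%C * (-1) ^+ bit v).
Proof.
rewrite mxE; move: v w; elim/ord2_ind; elim/ord2_ind;
  by rewrite /= ?mul0r ?mul1r ?expr0 ?expr1 ?mulr1 ?mulrN1 ?opprK.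
Qed.

Lemma pauliZE v w : pauliZ R v w = (w == v + false%:R)%:R * (-1) ^+ bit v.
Proof.
by rewrite mxE; move: v w; elim/ord2_ind; elim/ord2_ind; rewrite /= ?mul0r ?mul1r.
Qed.

Lemma scalar1E (v w : 'I_2) : (1%:M : 'M[R[i]]_2) v w = (w == v + false%:R)%:R.
Proof. by rewrite mxE; move: v w; elim/ord2_ind; elim/ord2_ind. Qed.

End TensorOp.

(** * The amplitude function of the code states *)

Section Tau.
Implicit Types (u v : 'I_5 -> bool) (a k : 'I_5).

Definition parity5 u := \big[addb/false]_k u k.
Definition cyclic_pairs u := \big[addb/false]_k (u k && u (k + 1)).

Lemma parity5E a u : parity5 u =
  u a (+) (u (a + 1) (+) (u (a - 1) (+) (u (a + 2) (+) u (a - 2)))).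
Proof. exact: big_ord5. Qed.

Lemma cyclic_pairsE a u : cyclic_pairs u =
  (u a && u (a + 1)) (+) (u (a + 1) && u (a + 2)) (+) (u (a - 1) && u a) (+)
  (u (a + 2) && u (a - 2)) (+) (u (a - 2) && u (a - 1)).
Proof.
rewrite /cyclic_pairs (big_ord5 _ _ a) /= !addbA.
have [-> -> -> ->] : [/\ a + 1 + 1 = a + 2, a - 1 + 1 = a, a + 2 + 1 = a - 2 &
    a - 2 + 1 = a - 1] by split; apply/eqP; move: a; elim/ord5_ind.
by [].
Qed.

(** The two products that contain [u a] both change by [u a], and these changes cancel. *)
Lemma flip_around a u v : (forall k, v k = u k (+) side_adj k a) ->
  parity5 v = parity5 u /\
  cyclic_pairs v = cyclic_pairs u (+) (u (a + 2) (+) u (a - 2)).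
Proof.
move=> vE; rewrite !(parity5E a) !(cyclic_pairsE a) !vE.
have [-> -> -> -> ->] : [/\ side_adj a a = false, side_adj (a + 1) a = true,
   side_adj (a - 1) a = true, side_adj (a + 2) a = false & side_adj (a - 2) a = false].
  by move: a {vE}; elim/ord5_ind.
by case: (u a); case: (u _); case: (u _); case: (u _); case: (u _).
Qed.

Lemma parity5_reindex (s : 'I_5 -> 'I_5) u : injective s ->
  parity5 (fun k => u (s k)) = parity5 u.
Proof. by move=> si; rewrite /parity5 [RHS](reindex_inj si). Qed.

Lemma cyclic_pairs_rot a u : cyclic_pairs (fun k => u (a + k)) = cyclic_pairs u.
Proof.
rewrite /cyclic_pairs [RHS](reindex_inj (addrI a)) /=.
by apply: eq_bigr => k _; rewrite addrA.
Qed.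

Lemma cyclic_pairs_refl a u : cyclic_pairs (fun k => u (a - k)) = cyclic_pairs u.
Proof.
have si : injective (fun k => a - 1 - k) by move=> k k' /addrI/oppr_inj.
rewrite /cyclic_pairs [RHS](reindex_inj si) /=.
apply: eq_bigr => k _; rewrite andbC; congr (u _ && u _); ring.
Qed.

(** The amplitudes of the graph state of the 5-cycle, restricted to parity [c]. The ring is a
    parameter so that finite identities can be computed over [int]. *)
Definition tau (F : pzRingType) (c : bool) u : F :=
  if parity5 u == c then (-1) ^+ cyclic_pairs u else 0.

Lemma eq_tau (F : pzRingType) c u v : u =1 v -> tau F c u = tau F c v.
Proof.
move=> uv; rewrite /tau; have -> : parity5 u = parity5 v by apply: eq_bigr.
by have -> : cyclic_pairs u = cyclic_pairs v by apply: eq_bigr => k _; rewrite !uv.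
Qed.

Lemma tau_rot (F : pzRingType) c a u : tau F c (fun k => u (a + k)) = tau F c u.
Proof. by rewrite /tau cyclic_pairs_rot parity5_reindex //; apply: addrI. Qed.

Lemma tau_refl (F : pzRingType) c a u : tau F c (fun k => u (a - k)) = tau F c u.
Proof.
rewrite /tau cyclic_pairs_refl parity5_reindex // => k k'.
by move/addrI/oppr_inj.
Qed.

End Tau.

Section CodeState.
Variables (R : realType) (c : bool) (psi : state R 5).
Hypothesis code : code_state c psi.
Implicit Types (x y : config 5) (r : 'I_5).

Definition bits L (x : config L) k := bit (x k).

Definition flip_at a x : config 5 := [ffun k => x k + (side_adj k a)%:R].

Lemma bits_flip_at a x k : bits (flip_at a x) k = bits x k (+) side_adj k a.
Proof. by rewrite /bits ffunE bitD. Qed.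

(** The stabilizer with the identity on leg [a] has X on the two neighbours of [a] and Z on the two
    other legs. *)
Lemma code_flip a x :
  psi x = (-1) ^+ (bits x (a + 2) (+) bits x (a - 2)) * psi (flip_at a x).
Proof.
case: code => _ /(_ (a + 1)) stab _; rewrite -{1}stab /stabilizer.
pose A k := nth 1%:M [:: pauliX R; pauliZ R; pauliZ R; pauliX R; 1%:M] (k - (a + 1))%R.
have [A0 A1 A2 A3 A4] : [/\ A (a + 1) = pauliX R, A (a + 2) = pauliZ R,
    A (a - 2) = pauliZ R, A (a - 1) = pauliX R & A a = 1%:M].
  by rewrite /A; move: a {stab A}; elim/ord5_ind.
rewrite (@tensor_op_monomial _ _ _ (fun k => side_adj k a)) -/A; last first.
  move=> k v; have : [|| k == a, k == a + 1, k == a - 1, k == a + 2 | k == a - 2].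
    by move: k a {stab A A0 A1 A2 A3 A4}; elim/ord5_ind; elim/ord5_ind.
  have [s1 s2 s3 s4 s5] : [/\ side_adj a a = false, side_adj (a + 1) a = true,
     side_adj (a - 1) a = true, side_adj (a + 2) a = false & side_adj (a - 2) a = false].
    by move: a {stab A A0 A1 A2 A3 A4}; elim/ord5_ind.
  case/or4P => [/eqP ->|/eqP ->|/eqP ->|/orP[] /eqP ->]; rewrite ?s1 ?s2 ?s3 ?s4 ?s5 -/(A _).
  - by rewrite A4 scalar1E => /negPf ->.
  - by rewrite A0 pauliXE => /negPf ->.
  - by rewrite A3 pauliXE => /negPf ->.
  - by rewrite A1 pauliZE => /negPf ->; rewrite mul0r.
  - by rewrite A2 pauliZE => /negPf ->; rewrite mul0r.
congr (_ * _); rewrite (big_ord5 _ _ a) -!/(A _) A0 A1 A2 A3 A4.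
have [-> -> -> -> ->] : [/\ side_adj a a = false, side_adj (a + 1) a = true,
   side_adj (a - 1) a = true, side_adj (a + 2) a = false & side_adj (a - 2) a = false].
  by move: a {stab A A0 A1 A2 A3 A4}; elim/ord5_ind.
by rewrite scalar1E !pauliXE !pauliZE !eqxx signr_addb /= !mulr1n !mul1r.
Qed.

Lemma code_parity x : parity5 (bits x) != c -> psi x = 0.
Proof.
case: code => _ _ /(_ x); rewrite (@tensor_op_monomial _ _ _ (fun=> false)); last first.
  by move=> k v /negPf vk; rewrite pauliZE vk mul0r.
have -> : [ffun k => x k + false%:R] = x by apply/ffunP => k; rewrite ffunE addr0.
have -> : \prod_k pauliZ R (x k) (x k + false%:R) = (-1) ^+ parity5 (bits x).
  rewrite /parity5 (big_morph (fun b : bool => (-1) ^+ b : R[i]) (@signr_addb _) erefl).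
  by apply: eq_bigr => k _; rewrite pauliZE eqxx mul1r.
have sgn (p q : bool) : p != q -> (-1) ^+ p - (-1) ^+ q != 0 :> R[i].
  have n2 : (1 : R[i]) + 1 != 0 by rewrite (_ : 1 + 1 = 2%:R) ?pnatr_eq0.
  by case: p; case: q => //= _; rewrite ?expr0 ?expr1 -?opprD ?oppr_eq0 ?opprK.
move=> /eqP; rewrite -subr_eq0 -mulrBl mulf_eq0 => /orP[/eqP E /sgn|/eqP //].
by rewrite E eqxx.
Qed.

(* Clears the bit r, at the cost of the bit r - 2; doing so for 0, 3, 1 and 4
   moves the parity of x to the bit 2. *)
Definition sweep_bit r x := if bits x r then flip_at (r - 1) x else x.
Let phi x := (-1) ^+ cyclic_pairs (bits x) * psi x.

(** By [code_flip] and [flip_around], a flip changes the amplitude and the quadratic phase by the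
    same sign, so [phi] is invariant. *)
Lemma sweep_bitP r x : [/\ phi (sweep_bit r x) = phi x,
  parity5 (bits (sweep_bit r x)) = parity5 (bits x), bits (sweep_bit r x) r = false &
  forall k, k != r -> k != r - 2 -> bits (sweep_bit r x) k = bits x k].
Proof.
rewrite /sweep_bit; case: ifP => // xr.
have [p q] := flip_around (bits_flip_at (r - 1) x).
split=> //; last first.
- move=> k kr kr2; rewrite bits_flip_at; suff -> : side_adj k (r - 1) = false by rewrite addbF.
  by move: r k kr kr2 {xr p q}; elim/ord5_ind; elim/ord5_ind.
- rewrite bits_flip_at xr; suff -> : side_adj r (r - 1) by [].
  by move: r {xr p q}; elim/ord5_ind.
rewrite /phi q [in RHS](code_flip (r - 1)) mulrA -signr_addb.
by [].
Qed.

Definition base_config : config 5 := [ffun k => ((k == 2) && c)%:R].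

Lemma code_phi x : parity5 (bits x) = c -> phi x = phi base_config.
Proof.
move=> px; have [f1 p1 z1 k1] := sweep_bitP 0 x.
have [f2 p2 z2 k2] := sweep_bitP 3 (sweep_bit 0 x).
have [f3 p3 z3 k3] := sweep_bitP 1 (sweep_bit 3 (sweep_bit 0 x)).
have [f4 p4 z4 k4] := sweep_bitP 4 (sweep_bit 1 (sweep_bit 3 (sweep_bit 0 x))).
rewrite -f1 -f2 -f3 -f4; set y := sweep_bit 4 _ in f4 p4 z4 k4 *.
have py : parity5 (bits y) = c by rewrite p4 p3 p2 p1.
have y0 : bits y 0 = false by rewrite k4 ?k3 ?k2.
have y3 : bits y 3 = false by rewrite k4 ?k3.
have y1 : bits y 1 = false by rewrite k4.
congr phi; apply/ffunP => k; apply: bit_inj; rewrite -[bit (y k)]/(bits y k) ffunE.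
rewrite -[(_ : bool)%:R]add0r bitD /=.
have [e1 e2 e3 e4] : [/\ (2 + 1 = 3 :> 'I_5), (2 - 1 = 1 :> 'I_5), (2 + 2 = 4 :> 'I_5) &
  (2 - 2 = 0 :> 'I_5)] by split; apply/eqP.
(* With the four other bits cleared, bit 2 is the parity [c]. *)
have := parity5E 2 (bits y); rewrite py e1 e2 e3 e4.
rewrite y0 y1 y3 z4 !addbF => ->.
by move: k; elim/ord5_ind; rewrite //= ?andbF ?andbT.
Qed.

Lemma code_stateE : exists2 alpha : R[i], alpha != 0 &
  forall x, psi x = alpha * tau _ c (bits x).
Proof.
have E x : psi x = phi base_config * tau _ c (bits x).
  rewrite /tau; case: eqP => [px|/eqP px]; last by rewrite mulr0 code_parity.
  by rewrite -(code_phi px) mulrAC /phi -signr_addb addbb mul1r.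
exists (phi base_config) => //; apply/eqP => z.
have z0 : \sum_(x : config 5) `|psi x| ^+ 2 = 0.
  by apply: big1 => x _; rewrite E z mul0r normr0 expr0n.
by case: code => c1 _ _; move: z0; rewrite c1 => /eqP; rewrite oner_eq0.
Qed.
End CodeState.

(** * Flipping a row of the network *)

Lemma prod_sign (F : pzRingType) (I : finType) (f : I -> bool) :
  \prod_i (-1) ^+ f i = (-1) ^+ (\big[addb/false]_i f i) :> F.
Proof.
by rewrite (big_morph (fun b : bool => (-1) ^+ b : F) (@signr_addb _) erefl).
Qed.

Section Majorana.
Variables (R : realType) (L : nat).
Implicit Types (x y : config L) (psi : state R L) (i j l : 'I_L).

Definition flip_site i x : config L := [ffun l => x l + (l == i)%:R].

Lemma bits_flip_site i x l : bits (flip_site i x) l = bits x l (+) (l == i).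
Proof. by rewrite /bits ffunE bitD. Qed.

Lemma bits_inj x y : bits x =1 bits y -> x = y.
Proof. by move=> xy; apply/ffunP => l; apply: bit_inj; apply: xy. Qed.

Lemma flip_siteK i : involutive (flip_site i).
Proof. by move=> x; apply: bits_inj => l; rewrite !bits_flip_site addbK. Qed.

Lemma flip_siteC i j x : flip_site i (flip_site j x) = flip_site j (flip_site i x).
Proof. by apply: bits_inj => l; rewrite !bits_flip_site addbAC. Qed.

Lemma prefix_parity_flip i x m :
  prefix_parity (bits (flip_site i x)) m = prefix_parity (bits x) m (+) (i < m)%N.
Proof.
rewrite /prefix_parity (eq_bigr _ (fun l _ => bits_flip_site i x l)) big_split /=.
congr (_ (+) _); rewrite big_mkcond (bigD1 i) //= eqxx big1 ?addbF //.
  by case: ifP.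
by move=> l /negPf ->; rewrite if_same.
Qed.

Lemma majoranaE (m : 'I_(2 * L)) i psi x : m./2 = i ->
  majorana m psi x = (-1) ^+ prefix_parity (bits x) i *
    (if odd m then - 'i%C * (-1) ^+ bits x i else 1) * psi (flip_site i x).
Proof.
move=> mi; rewrite /majorana (@tensor_op_monomial _ _ _ (fun l => l == i)); last first.
  move=> l v; rewrite mi (_ : (l == i) = (l == i :> nat)) //.
  case: (ltngtP l i) => li /negPf nv.
  - by rewrite pauliZE nv mul0r.
  - by rewrite scalar1E nv.
  - by case: ifP => _; rewrite ?pauliYE ?pauliXE nv ?mul0r.
congr (_ * _); rewrite (bigD1 i) //= mi ltnn eqxx mulrC; congr (_ * _).
  have -> : prefix_parity (bits x) i =
      \big[addb/false]_(l < L) (if (l < i)%N then bits x l else false).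
    by rewrite /prefix_parity big_mkcond.
  rewrite -prod_sign [RHS](bigD1 i) //= ltnn mul1r.
  apply: eq_bigr => l; rewrite (_ : (l == i) = (l == i :> nat)) //.
  case: (ltngtP l i) => // li _.
    by rewrite pauliZE eqxx mul1r.
  by rewrite scalar1E eqxx.
by rewrite eqxx; case: ifP => _; rewrite ?pauliYE ?pauliXE eqxx ?mul1r.
Qed.

Lemma majorana_pair (mi mj : 'I_(2 * L)) i j psi (e : bool) :
  i != j -> mi./2 = i -> mj./2 = j -> ~~ odd mi -> odd mj ->
  (forall y, psi (flip_site j (flip_site i y)) =
     (-1) ^+ (e (+) prefix_parity (bits y) i (+) prefix_parity (bits y) j
              (+) bits y j) * psi y) ->
  exists p : bool, forall x,
    majorana mi psi x = (-1) ^+ p * 'i%C * majorana mj psi x.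
Proof.
(* The relation is applied to [flip_site j x]: [j < i] is the effect of that flip on the string of
   [i], and [true] its effect on the bit [j]. *)
move=> ij mii mjj omi omj H; exists (e (+) (j < i)%N (+) true) => x.
rewrite (majoranaE _ _ mii) (majoranaE _ _ mjj) (negPf omi) omj mulr1.
rewrite -[flip_site i x](flip_siteK j) -[flip_site j (flip_site i x)]flip_siteC H.
rewrite !prefix_parity_flip bits_flip_site eqxx ltnn.
set p := prefix_parity _ _; set q := prefix_parity _ _; set s := bits x j.
rewrite !mulrA -!signr_addb; set z := psi _.
have -> : (-1) ^+ (e (+) (j < i)%N (+) true) * 'i%C * (-1) ^+ q * - 'i%C * (-1) ^+ s =
          (-1) ^+ (e (+) (j < i)%N (+) true (+) q (+) s) :> R[i].
  rewrite !signr_addb mulrAC -!mulrA; congr (_ * _); congr (_ * _); congr (_ * _).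
  transitivity (- ('i%C * 'i%C) * ((-1) ^+ q * (-1) ^+ s) : R[i]); first by ring.
  by rewrite -expr2 sqr_i opprK mul1r.
congr ((-1) ^+ _ * _); case: e {H}; case: p; case: q; case: s; by case: (j < i)%N.
Qed.
End Majorana.

Section Network.
Variables (R : realType) (P : {fset 'M[R]_3}) (N : nat) (bd : N.-tuple (P * 'I_5)).
Hypothesis tileP : forall g, g \in P -> tile g.
Hypothesis bdP : clockwise_boundary bd.
Implicit Types (g : P) (X : index_values P) (y : config N) (b : {ffun P -> bool}).

Definition tile_bits X g (k : 'I_5) : bool := bit (X (g, k)).

Definition compatible X y := contracted X && [forall i : 'I_N, X (tnth bd i) == y i].

Definition net_weight b X : R[i] := \prod_g tau R[i] (b g) (tile_bits X g).

Definition net_state b : state R N :=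
  [ffun y => \sum_(X | compatible X y) net_weight b X].

Lemma iter_turn (d : side R) m : iter m (@turn R) d =
  (d.1, if \det d.1 == 1 then d.2 + m%:R else d.2 - m%:R).
Proof.
elim: m => [|m IH] /=; first by rewrite addr0 subr0 if_same; case: d.
by rewrite IH /turn /= -[m.+1%:R]natr1; case: (\det d.1 == 1); rewrite ?opprD addrA.
Qed.

(** A starting label or an orientation acts on the legs of a tile by a rotation or a reflection of
    the 5-cycle, under which [tau] is invariant. *)
Lemma boundary_stateE (start : P -> 'I_5) (code : bool -> state R 5) (alpha : bool -> R[i]) b :
  (forall c x, code c x = alpha c * tau _ c (bits x)) ->
  forall y, boundary_state bd start code b y = (\prod_g alpha (b g)) * net_state b y.
Proof.
move=> codeE y; rewrite !ffunE big_distrr /=; apply: eq_bigr => X _.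
rewrite /net_weight -big_split /=; apply: eq_bigr => g _; rewrite codeE; congr (_ * _).
transitivity (tau R[i] (b g) (fun j : 'I_5 => tile_bits X g
    (if \det (val g) == 1 then start g + j else start g - j))).
  apply: eq_tau => j; rewrite /bits ffunE /leg iter_turn /tile_bits /=.
  have -> // : (nat_of_ord j)%:R = j.
  by move: j; elim/ord5_ind; apply/eqP.
by case: (_ == 1); rewrite ?(tau_rot _ _ _ (tile_bits X g)) ?(tau_refl _ _ _ (tile_bits X g)).
Qed.

Lemma matched_contracted X : contracted X -> matched (fun d => bit (X d)).
Proof.
by move=> /forallP cX d e /eqP de; move: (cX d) => /forallP/(_ e); rewrite de => /eqP ->.
Qed.

Section OneDimer.
Variables (n : nat) (x y : flag R) (i j : 'I_N).
Hypotheses (bx : boundary_flag P x) (by_ : boundary_flag P y).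
Hypothesis xy : linked_by P n x y.
Hypotheses (cx : clockwise_flag x) (cy : ~~ clockwise_flag y).
Hypotheses (xi : x.1 = bd_side bd i) (yj : y.1 = bd_side bd j).

Let a := x.2.
Let cutx : P * 'I_5 -> bool := crossing_leg n x.

Definition flip_cut X : index_values P := [ffun d => X d + (cutx d)%:R].

Lemma flip_cutK : involutive flip_cut.
Proof. by move=> X; apply/ffunP => d; rewrite !ffunE addKb2. Qed.

Lemma compatible_flip_cut X z :
  compatible (flip_cut X) (flip_site j (flip_site i z)) = compatible X z.
Proof.
rewrite /compatible; congr (_ && _).
  apply: eq_forallb => d; apply: eq_forallb => e.
  case: eqP => //= de; rewrite !ffunE.
  have id : internal d.
    by rewrite /internal -[_ *m _]/((cross (patch_side d)).1) -de; apply: valP.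
  have -> : e = partner d by apply: patch_side_inj; rewrite partnerE.
  by rewrite /cutx (crossing_leg_internal bx by_ xy) // (inj_eq (addIr _)).
apply: eq_forallb => l; rewrite !ffunE /cutx (crossing_leg_bd bdP bx by_ xy cx cy xi yj).
have bE (v w : 'I_2) : (v == w) = (bit v == bit w) by rewrite (inj_eq bit_inj).
rewrite [LHS]bE [RHS]bE !bitD.
by case: (bit (X _)); case: (bit (z l)); case: (l == i); case: (l == j).
Qed.

(** In each tile of the row the two neighbours of the side along the line are flipped, and
    [flip_around] applies. *)
Lemma net_weight_flip_cut b X : net_weight b (flip_cut X) =
  (-1) ^+ far_parity n x (fun d => bit (X d)) * net_weight b X.
Proof.
rewrite /far_parity -prod_sign -big_split; apply: eq_bigr => g _ /=.
rewrite -/a -/(tile_bits X g _) -/(tile_bits X g _).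
have tE k : tile_bits (flip_cut X) g k = tile_bits X g k (+) cutx (g, k).
  by rewrite /tile_bits ffunE bitD.
rewrite /cutx /crossing_leg /= -/a in tE.
case og: (on_run n x (val g)); rewrite og /= in tE; last first.
  by rewrite mul1r; apply: eq_tau => k; rewrite tE addbF.
have [p q] := flip_around tE.
rewrite /tau p q; case: eqP => // _; last by rewrite mulr0.
by rewrite signr_addb mulrC.
Qed.

Lemma net_flip : exists e : (P -> bool) -> bool, forall b z,
  net_state b (flip_site j (flip_site i z)) =
    (-1) ^+ (e b (+) prefix_parity (bits z) i (+) prefix_parity (bits z) j (+) bits z j)
    * net_state b z.
Proof.
have [e eP] := far_parityE tileP bdP bx by_ xy cx cy xi yj.
exists e => b z; rewrite !ffunE (reindex_inj (can_inj flip_cutK)) /=.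
rewrite (eq_bigl _ _ (fun X => compatible_flip_cut X z)) big_distrr /=.
apply: eq_bigr => X /andP[cX /forallP agree]; rewrite net_weight_flip_cut.
set chi := fun d => bit (X d).
(* Terms whose tile parities differ from [b] have weight zero; in all others the sign depends on the
   input [b] and on [z] only. *)
have [E|] := boolP [forall g, tile_parity chi g == b g]; last first.
  rewrite negb_forall => /existsP[g ng].
  suff -> : net_weight b X = 0 by rewrite !mulr0.
  by rewrite /net_weight (bigD1 g) //= /tau -[parity5 _]/(tile_parity chi g) (negPf ng) mul0r.
congr ((-1) ^+ _ * _); rewrite (eP _ (matched_contracted cX)).
have -> : tile_parity chi = b by apply/funext => g; apply/eqP; apply: (forallP E).
rewrite /chi (eqP (agree j)) (_ : (fun l => _) = bits z) //.
by apply/funext => l; rewrite /= (eqP (agree l)).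
Qed.
End OneDimer.
End Network.

(** * Inner products of boundary states *)

Lemma tau_int (F : pzRingType) c u : tau F c u = (tau int c u)%:~R.
Proof. by rewrite /tau; case: ifP => _; rewrite ?mulr0z // rmorphXn /= mulrN1z. Qed.

(* The values of u at a, a+1, a-1, a+2, a-2 are x0, x1, x2, x3, x4. *)
Lemma tauE (F : pzRingType) c u a : tau F c u =
  (fun x0 x1 x2 x3 x4 : bool =>
     if x0 (+) (x1 (+) (x2 (+) (x3 (+) x4))) == c
     then (-1) ^+ ((x0 && x1) (+) (x1 && x3) (+) (x2 && x0) (+) (x3 && x4) (+) (x4 && x2))
     else 0) (u a) (u (a + 1)) (u (a - 1)) (u (a + 2)) (u (a - 2)).
Proof. by rewrite /tau (parity5E a) (cyclic_pairsE a). Qed.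

Definition shift_bits a (s : bool * bool * bool) (k : 'I_5) : bool :=
  if k == a then s.1.1 else if k == a + 1 then s.1.2 else if k == a - 1 then s.2 else false.

Lemma shift_bitsE a s : [/\ shift_bits a s a = s.1.1, shift_bits a s (a + 1) = s.1.2,
  shift_bits a s (a - 1) = s.2, shift_bits a s (a + 2) = false & shift_bits a s (a - 2) = false].
Proof. by rewrite /shift_bits; move: a; elim/ord5_ind; split. Qed.

Lemma sum_bool3 (V : nmodType) (f : bool * bool * bool -> V) : \sum_s f s =
  f (true, true, true) + f (true, true, false) + (f (true, false, true) + f (true, false, false))
  + (f (false, true, true) + f (false, true, false) +
     (f (false, false, true) + f (false, false, false))).
Proof.
have -> : \sum_s f s = \sum_x \sum_y \sum_z f (x, y, z).
  by rewrite !pair_big /=; apply: eq_bigr => -[[]].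
by rewrite !big_bool.
Qed.

(** The two remaining legs are maximally entangled with the three summed ones, and reveal nothing
    about the input. Half of the eight patterns have the right parity, hence the [4]. *)
Lemma tau_two_uniform (F : pzRingType) c c' u u' a :
  u a = u' a -> u (a + 1) = u' (a + 1) -> u (a - 1) = u' (a - 1) ->
  \sum_s tau F c (fun k => u k (+) shift_bits a s k) *
         tau F c' (fun k => u' k (+) shift_bits a s k) =
  if [&& c == c', u (a + 2) == u' (a + 2) & u (a - 2) == u' (a - 2)] then 4 else 0.
Proof.
move=> e0 e1 e2.
have E : \sum_s tau int c (fun k => u k (+) shift_bits a s k) *
         tau int c' (fun k => u' k (+) shift_bits a s k) =
  if [&& c == c', u (a + 2) == u' (a + 2) & u (a - 2) == u' (a - 2)] then 4 else 0.
  transitivity (\sum_(s : bool * bool * bool)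
    (fun x0 x1 x2 x3 x4 y3 y4 : bool =>
     (if x0 (+) (x1 (+) (x2 (+) (x3 (+) x4))) == c
     then (-1) ^+ ((x0 && x1) (+) (x1 && x3) (+) (x2 && x0) (+) (x3 && x4) (+) (x4 && x2))
     else 0 : int) *
     (if x0 (+) (x1 (+) (x2 (+) (y3 (+) y4))) == c'
     then (-1) ^+ ((x0 && x1) (+) (x1 && y3) (+) (x2 && x0) (+) (y3 && y4) (+) (y4 && x2))
     else 0))
     (u a (+) s.1.1) (u (a + 1) (+) s.1.2) (u (a - 1) (+) s.2) (u (a + 2)) (u (a - 2))
     (u' (a + 2)) (u' (a - 2))).
    apply: eq_bigr => s _; rewrite !(tauE _ _ _ a).
    by have [-> -> -> -> ->] := shift_bitsE a s; rewrite !addbF e0 e1 e2.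
  rewrite sum_bool3 /=.
  case: c; case: c'; case: (u a); case: (u (a + 1)); case: (u (a - 1));
  case: (u (a + 2)); case: (u (a - 2)); case: (u' (a + 2)); case: (u' (a - 2));
  by vm_compute.
transitivity ((\sum_s tau int c (fun k => u k (+) shift_bits a s k) *
         tau int c' (fun k => u' k (+) shift_bits a s k))%:~R : F); last first.
  by rewrite E; case: ifP.
rewrite rmorph_sum; apply: eq_bigr => s _.
by rewrite rmorphM /= -!tau_int.
Qed.

(** The marked labels are at most two, and consecutive. *)
Lemma free_three (p : 'I_5 -> bool) : (forall k, ~~ (p k && p (k + 2))) ->
  exists a, [/\ ~~ p a, ~~ p (a + 1) & ~~ p (a - 1)].
Proof.
move=> H.
have [e0 e1 e2 e3 e4] : [/\ (0 + 1 = 1 :> 'I_5), (1 + 1 = 2 :> 'I_5), (2 + 1 = 3 :> 'I_5),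
  (3 + 1 = 4 :> 'I_5) & (4 + 1 = 0 :> 'I_5)] by split; apply/eqP.
have [f0 f1 f2 f3 f4] : [/\ (0 - 1 = 4 :> 'I_5), (1 - 1 = 0 :> 'I_5), (2 - 1 = 1 :> 'I_5),
  (3 - 1 = 2 :> 'I_5) & (4 - 1 = 3 :> 'I_5)] by split; apply/eqP.
have [g0 g1 g2 g3 g4] : [/\ (0 + 2 = 2 :> 'I_5), (1 + 2 = 3 :> 'I_5), (2 + 2 = 4 :> 'I_5),
  (3 + 2 = 0 :> 'I_5) & (4 + 2 = 1 :> 'I_5)] by split; apply/eqP.
have := (H 0, H 1, H 2, H 3, H 4); rewrite g0 g1 g2 g3 g4 => {H} H.
have : [|| [&& ~~ p 0, ~~ p 1 & ~~ p 4], [&& ~~ p 1, ~~ p 2 & ~~ p 0],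
  [&& ~~ p 2, ~~ p 3 & ~~ p 1], [&& ~~ p 3, ~~ p 4 & ~~ p 2] | [&& ~~ p 4, ~~ p 0 & ~~ p 3]].
  by case: H => [[[[]]]]; case: (p 0); case: (p 1); case: (p 2); case: (p 3); case: (p 4).
case/or4P => [/and3P[]|/and3P[]|/and3P[]|/orP[] /and3P[]] *.
- by exists 0; rewrite e0 f0.
- by exists 1; rewrite e1 f1.
- by exists 2; rewrite e2 f2.
- by exists 3; rewrite e3 f3.
- by exists 4; rewrite e4 f4.
Qed.

Lemma around_cases (a k : 'I_5) : [|| k \in [:: a; a + 1; a - 1], k == a + 2 | k == a - 2].
Proof. by move: k a; elim/ord5_ind; elim/ord5_ind. Qed.

Section Gram.
Variables (R : realType) (P : {fset 'M[R]_3}).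
Hypothesis tileP : forall g, g \in P -> tile g.
Implicit Types (g h : P) (X : index_values P) (b : {ffun P -> bool}) (Q : {set P}).
Implicit Types (d e : P * 'I_5).

Let r := reflection R.

(* The sides along which the tiles of Q are contracted with each other. *)
Definition inner Q d := [&& internal d, d.1 \in Q & (partner d).1 \in Q].

Definition agree Q X X' := [forall d, ~~ inner Q d ==> (X d == X' d)].

(* The inner product of the contractions of the tiles of Q for the inputs b and
   b', up to a factor: the values on the sides outside Q are free. *)
Definition overlap Q b b' : R[i] :=
  \sum_(Z : index_values P * index_values P |
        [&& contracted Z.1, contracted Z.2 & agree Q Z.1 Z.2])
   \prod_(g in Q) (tau R[i] (b g) (tile_bits Z.1 g) * tau R[i] (b' g) (tile_bits Z.2 g)).

Section Step.
Variables (h : P) (a : 'I_5).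

(** Both names of each side of [h] are included, so that shifting them keeps contracted values
    equal. *)
Definition at_tile d := (d.1 == h) || internal d && ((partner d).1 == h).

Definition shift_legs s X : index_values P :=
  [ffun d => X d + (at_tile d && shift_bits a s d.2)%:R].

Lemma shift_legsK s : involutive (shift_legs s).
Proof. by move=> X; apply/ffunP => d; rewrite !ffunE addKb2. Qed.

Lemma partner_label d : (partner d).2 = d.2.
Proof. by rewrite /partner; case: insub. Qed.

Lemma contractedP X : reflect (forall d, internal d -> X (partner d) = X d) (contracted X).
Proof.
apply: (iffP forallP) => [H d id|H d].
  have /forallP/(_ (partner d)) := H d.
  by rewrite (partnerE id) eqxx => /eqP.
apply/forallP => e; apply/implyP => /eqP de.
have id : internal d.
  by rewrite /internal -[_ *m _]/((cross (patch_side d)).1) -de; apply: valP.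
have -> : e = partner d by apply: patch_side_inj; rewrite partnerE.
by rewrite H.
Qed.

Lemma at_tile_partner d : internal d -> at_tile (partner d) = at_tile d.
Proof.
move=> id; have [ip pp _] := internal_partner tileP id.
by rewrite /at_tile ip pp id /= orbC.
Qed.

Lemma contracted_shift s X : contracted (shift_legs s X) = contracted X.
Proof.
apply/contractedP/contractedP => H d id; have := H d id;
  rewrite !ffunE at_tile_partner // partner_label; last by move=> ->.
by move/addIr.
Qed.

Lemma agree_shift Q s X X' : agree Q (shift_legs s X) (shift_legs s X') = agree Q X X'.
Proof. by apply: eq_forallb => d; rewrite !ffunE (inj_eq (addIr _)). Qed.

Variable Q : {set P}.
Hypothesis hQ : h \in Q.
Hypothesis outer : forall k, k \in [:: a; a + 1; a - 1] -> ~~ inner Q (h, k).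

Lemma shift_bits_supp s k : k \notin [:: a; a + 1; a - 1] -> shift_bits a s k = false.
Proof. by rewrite !inE !negb_or /shift_bits => /and3P[/negPf -> /negPf -> /negPf ->]. Qed.

Lemma tile_bits_shift s X g : g \in Q -> g != h ->
  tile_bits (shift_legs s X) g =1 tile_bits X g.
Proof.
move=> gQ gh k; rewrite /tile_bits ffunE bitD /at_tile (negPf gh) /=.
case: (boolP (internal (g, k))) => //= id; last by rewrite addbF.
case: eqP => [ph|_]; last by rewrite addbF.
have [ip pp _] := internal_partner tileP id.
have E : partner (g, k) = (h, k) by rewrite [LHS]surjective_pairing ph partner_label.
rewrite shift_bits_supp ?addbF //; apply/negP => /outer.
by rewrite -E /inner ip pp ph /= hQ gQ.
Qed.

Lemma tile_bits_shift_self s X k :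
  tile_bits (shift_legs s X) h k = tile_bits X h k (+) shift_bits a s k.
Proof. by rewrite /tile_bits ffunE bitD /at_tile eqxx. Qed.

(** Removing [h] frees its inner sides, which by [outer] can only be those numbered [a + 2] and
    [a - 2]. *)
Lemma agree_remove X X' : contracted X -> contracted X' ->
  agree (Q :\ h) X X' = [&& agree Q X X', tile_bits X h (a + 2) == tile_bits X' h (a + 2) &
                            tile_bits X h (a - 2) == tile_bits X' h (a - 2)].
Proof.
move=> cX cX'.
have outh k : ~~ inner (Q :\ h) (h, k) by rewrite /inner /= !inE eqxx andbF.
apply/idP/and3P => [/forallP H|[/forallP H e2 e3]].
  split; first last.
  - by rewrite /tile_bits (inj_eq bit_inj); apply: (implyP (H _) (outh _)).
  - by rewrite /tile_bits (inj_eq bit_inj); apply: (implyP (H _) (outh _)).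
  apply/forallP => d; apply/implyP => nd; apply: (implyP (H d)).
  by apply: contra nd => /and3P[id]; rewrite !inE /inner id => /andP[_ ->] /andP[_ ->].
have Hh k : X (h, k) = X' (h, k).
  case/or3P: (around_cases a k) => [/outer nk|/eqP ->|/eqP ->].
  - by apply/eqP; apply: (implyP (H _)).
  - exact: bit_inj (eqP e2).
  - exact: bit_inj (eqP e3).
apply/forallP => d; apply/implyP => nd.
case: (boolP (inner Q d)) => [/and3P[id dQ pQ]|ndQ]; last exact: (implyP (H d)).
have [dh|dh] := eqVneq d.1 h; first by rewrite [d]surjective_pairing dh Hh.
have [ph|ph] := eqVneq (partner d).1 h.
  rewrite -(contractedP _ cX d id) -(contractedP _ cX' d id).
  by rewrite [partner d]surjective_pairing ph Hh.
by move: nd; rewrite /inner id !inE dh ph dQ pQ.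
Qed.

(* Average over the simultaneous flips of the three edges of h around a, which no
   other tile of Q sees. *)
Lemma overlap_step b b' : overlap Q b b' * 8 = (b h == b' h)%:R * 4 * overlap (Q :\ h) b b'.
Proof.
pose W (Z : index_values P * index_values P) : R[i] :=
  \prod_(g in Q :\ h) (tau R[i] (b g) (tile_bits Z.1 g) * tau R[i] (b' g) (tile_bits Z.2 g)).
pose V (Z : index_values P * index_values P) (s : bool * bool * bool) : R[i] :=
  tau R[i] (b h) (fun k => tile_bits Z.1 h k (+) shift_bits a s k) *
  tau R[i] (b' h) (fun k => tile_bits Z.2 h k (+) shift_bits a s k).
pose C Q' (Z : index_values P * index_values P) :=
  [&& contracted Z.1, contracted Z.2 & agree Q' Z.1 Z.2].
have E s : overlap Q b b' = \sum_(Z | C Q Z) V Z s * W Z.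
  pose sh (Z : index_values P * index_values P) := (shift_legs s Z.1, shift_legs s Z.2).
  have shK : involutive sh by case=> X X'; rewrite /sh /= !shift_legsK.
  rewrite /overlap (reindex_inj (can_inj shK)) /=.
  apply: eq_big => [Z|Z _]; first by rewrite !contracted_shift agree_shift.
  rewrite (bigD1 h) //=; congr (_ * _).
    by congr (_ * _); apply: eq_tau => k; apply: tile_bits_shift_self.
  rewrite /W; apply: eq_big => [g|g /andP[gQ gh]]; first by rewrite !inE andbC.
  by congr (_ * _); apply: eq_tau; apply: tile_bits_shift.
(* Each of the eight shifts gives another expression of the same overlap. *)
have -> : overlap Q b b' * 8 = \sum_(s : bool * bool * bool) \sum_(Z | C Q Z) V Z s * W Z.
  rewrite -(eq_bigr _ (fun s _ => E s)) sumr_const card_prod card_prod card_bool.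
  by rewrite -[(2 * 2 * 2)%N]/8%N mulr_natr.
rewrite exchange_big /= /overlap big_distrr /=.
rewrite [RHS](eq_bigl (fun Z => C Q Z && ((tile_bits Z.1 h (a + 2) == tile_bits Z.2 h (a + 2)) &&
                            (tile_bits Z.1 h (a - 2) == tile_bits Z.2 h (a - 2))))); last first.
  by move=> Z; rewrite /C; case c1: (contracted _) => //; case c2: (contracted _) => //=;
    rewrite agree_remove.
rewrite [RHS]big_mkcondr /=; apply: eq_bigr => Z /and3P[c1 c2 /forallP ag].
rewrite -big_distrl /= tau_two_uniform; first last.
- by rewrite /tile_bits (eqP (implyP (ag (h, a - 1)) _)) // outer // !inE eqxx !orbT.
- by rewrite /tile_bits (eqP (implyP (ag (h, a + 1)) _)) // outer // !inE eqxx !orbT.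
- by rewrite /tile_bits (eqP (implyP (ag (h, a)) _)) // outer // !inE eqxx.
rewrite -/(W Z); case: (b h == b' h) => /=; last by rewrite !mul0r if_same.
by rewrite mul1r; case: ifP => _; rewrite ?mul0r.
Qed.
End Step.
End Gram.

(** * Removal of the tiles one by one *)

Section Norm.
Variables (R : realType) (P : {fset 'M[R]_3}).
Hypothesis tileP : forall g, g \in P -> tile g.
Implicit Types (g h : P) (X : index_values P) (b : {ffun P -> bool}) (Q : {set P}).
Implicit Types (d e : P * 'I_5).

Lemma free_tile Q : Q != finset.set0 -> exists h a, h \in Q /\
  forall k, k \in [:: a; a + 1; a - 1] -> ~~ inner Q (h, k).
Proof.
case/finset.set0Pn => h0 h0Q; pose c := pentagon_center R.
pose f g := mink (val g *m c) c.
case: (arg_minP f h0Q) => h hQ hmin.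
have th := tileP (valP h).
(* The sides that separate [h] from the centre; no two non-adjacent sides do so. *)
pose p k := 0 < mink (val h *m normal R k) c.
have [a [a0 a1 a2]] : exists a, [/\ ~~ p a, ~~ p (a + 1) & ~~ p (a - 1)].
  apply: free_three => k; apply/negP => /andP[p0 p2].
  exact: (tile_nonadj (i := k) th).
exists h, a; split => // k ka.
have {a0 a1 a2 ka} : ~~ p k by move: ka; rewrite !inE => /or3P[] /eqP ->.
rewrite /p -leNgt le_eqVlt (negPf (mink_root_center k th)) /= => hk.
(* Crossing any other side leads further from the centre, so a tile of [Q] found there would
   contradict the minimality of [h]. *)
apply/negP => /and3P[id _ pQ]; have := hmin _ pQ.
have := partnerE id; rewrite /f; case: (partner _) => g k'; rewrite /cross /patch_side /=.
case=> -> _; rewrite -mulmxA reflectionE mulmxBr -scalemxAr minkBl minkZl.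
have := mink_normal_center R k; rewrite -/c => nk; nra.
Qed.

Lemma contracted0 : contracted ([ffun=> 0] : index_values P).
Proof. by apply/(contractedP _) => d _; rewrite !ffunE. Qed.

Lemma overlapE Q : exists2 K : R[i], K != 0 & forall b b',
  overlap Q b b' = [forall g in Q, b g == b' g]%:R * K.
Proof.
elim: {Q}#|Q| {-2}Q (erefl #|Q|) => [|m IH] Q cQ.
  have -> : Q = finset.set0 by apply/eqP; rewrite -cards_eq0 cQ.
  exists (\sum_(Z : index_values P * index_values P |
     [&& contracted Z.1, contracted Z.2 & agree finset.set0 Z.1 Z.2]) 1).
    rewrite sumr_const pnatr_eq0 -lt0n; apply/card_gt0P.
    exists ([ffun=> 0], [ffun=> 0]); rewrite unfold_in /= !contracted0 /=.
    by apply/forallP => d; rewrite eqxx implybT.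
  move=> b b'; have -> : [forall g in finset.set0, b g == b' g].
    by apply/forall_inP => g; rewrite inE.
  by rewrite mul1r; apply: eq_bigr => Z _; rewrite finset.big_set0.
have /free_tile[h [a [hQ ha]]] : Q != finset.set0 by rewrite -cards_eq0 cQ.
have [|K K0 KE] := IH (Q :\ h); first by move: cQ; rewrite (cardsD1 h) hQ => -[].
have e8 : (8 : R[i]) != 0 by rewrite pnatr_eq0.
have e4 : (4 : R[i]) != 0 by rewrite pnatr_eq0.
(* Each removed tile contributes the factor of [overlap_step]. *)
exists (4 / 8 * K) => [|b b']; first by rewrite !mulf_neq0 ?invr_eq0.
apply: (mulIf e8); rewrite (overlap_step tileP hQ ha) KE.
have -> : [forall g in Q, b g == b' g] = (b h == b' h) && [forall g in Q :\ h, b g == b' g].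
  apply/forall_inP/andP => [H|[bh /forall_inP H] g gQ].
    by split; [apply: H|apply/forall_inP => g; rewrite !inE => /andP[_ /H]].
  by have [->//|gh] := eqVneq g h; apply: H; rewrite !inE gh.
by rewrite -mulnb natrM; field.
Qed.

Variables (N : nat) (bd : N.-tuple (P * 'I_5)).
Hypothesis bdP : clockwise_boundary bd.

Lemma agree_setT X X' : agree [set: P] X X' = [forall i, X (tnth bd i) == X' (tnth bd i)].
Proof.
have nin d : (d \in bd) = ~~ inner [set: P] d.
  rewrite /inner !inE !andbT; case: bdP => _ bdE _.
  by apply/idP/idP => /bdE.
apply/forallP/forallP => H => [i|d].
  by apply: (implyP (H _)); rewrite -nin mem_tnth.
by apply/implyP; rewrite -nin => /tnthP[i ->].
Qed.

(** Summing over [y] leaves the pairs of index values that agree on the boundary, the only sides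
    that are not inner when [Q] is the whole patch. *)
Lemma net_state_gram b b' :
  \sum_y net_state bd b y * net_state bd b' y = overlap [set: P] b b'.
Proof.
rewrite /overlap.
transitivity (\sum_y \sum_(Z : index_values P * index_values P |
     compatible bd Z.1 y && compatible bd Z.2 y) net_weight b Z.1 * net_weight b' Z.2).
  apply: eq_bigr => y _; rewrite !ffunE big_distrl /=.
  rewrite -(pair_big (fun X => compatible bd X y) (fun X => compatible bd X y)
      (fun X X' => net_weight b X * net_weight b' X')) /=.
  by apply: eq_bigr => X _; rewrite big_distrr.
rewrite (exchange_big_dep (fun Z : index_values P * index_values P =>
   [&& contracted Z.1, contracted Z.2 & agree [set: P] Z.1 Z.2])) /=; last first.
  move=> y Z _ /andP[/andP[-> /forallP H1] /andP[-> /forallP H2]] /=.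
  by rewrite agree_setT; apply/forallP => i; rewrite (eqP (H1 i)) eq_sym.
apply: eq_bigr => Z /and3P[c1 c2]; rewrite agree_setT => /forallP ag.
pose y : config N := [ffun i => Z.1 (tnth bd i)].
rewrite (big_pred1 y) => [|y' /=].
  rewrite /net_weight -big_split /=; apply: eq_big => // g; first by rewrite inE.
rewrite /compatible c1 c2 /=; apply/andP/eqP => [[/forallP H _]|->].
  by apply/ffunP => i; rewrite ffunE (eqP (H i)).
split; apply/forallP => i; rewrite ffunE //.
by rewrite eq_sym.
Qed.
End Norm.

(** * Dimer states with equal parities are not orthogonal *)

Section Words.
Variables (R : realType) (L : nat).
Implicit Types (x y z : config L) (psi phi : state R L) (i j l : 'I_L).
Implicit Types (m k : 'I_(2 * L)) (w u v : seq 'I_(2 * L)).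

Lemma half_mode m : (m./2 < L)%N.
Proof. by rewrite ltn_half_double -mul2n. Qed.

Definition site m : 'I_L := Ordinal (half_mode m).

Definition mode_phase m x : R[i] := (-1) ^+ prefix_parity (bits x) (site m) *
  (if odd m then - 'i%C * (-1) ^+ bits x (site m) else 1).

Lemma majorana_siteE m psi x :
  majorana m psi x = mode_phase m x * psi (flip_site (site m) x).
Proof. exact: majoranaE. Qed.

Lemma mode_phase_flip m i x : mode_phase m (flip_site i x) =
  (-1) ^+ ((i < site m)%N (+) (odd m && (i == site m))) * mode_phase m x.
Proof.
rewrite /mode_phase prefix_parity_flip bits_flip_site [site m == i]eq_sym.
rewrite !signr_addb; case: (odd m) => /=; last by ring.
by ring.
Qed.

Lemma mode_phase_sqr m x : mode_phase m x * mode_phase m (flip_site (site m) x) = 1.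
Proof.
rewrite mode_phase_flip ltnn eqxx /= andbT /mode_phase.
have sq (b : bool) : (-1) ^+ b * (-1) ^+ b = 1 :> R[i] by rewrite -signr_addb addbb.
set p := prefix_parity _ _; set s := bits _ _; case: (odd m) => /=.
  transitivity (- ('i%C * 'i%C) * ((-1) ^+ p * (-1) ^+ p) * ((-1) ^+ s * (-1) ^+ s) : R[i]).
    by rewrite expr1; ring.
  by rewrite !sq !mulr1 -expr2 sqr_i opprK.
by rewrite expr0 mul1r !mulr1 sq.
Qed.

Lemma majoranaK m psi : majorana m (majorana m psi) = psi.
Proof.
apply/ffunP => x; rewrite !majorana_siteE flip_siteK mulrA mode_phase_sqr.
by rewrite mul1r.
Qed.

Lemma mode_eq m k : site m = site k -> odd m = odd k -> m = k.
Proof.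
move=> /(congr1 val) /= s o; apply: val_inj => /=.
by rewrite -(odd_double_half m) -(odd_double_half k) s o.
Qed.

(** At distinct sites exactly one Jordan-Wigner string is changed by the other flip; at the same
    site the sign comes from the odd mode. *)
Lemma majorana_anticommute m k psi x : m != k ->
  majorana m (majorana k psi) x = - majorana k (majorana m psi) x.
Proof.
move=> mk; rewrite !majorana_siteE flip_siteC !mode_phase_flip.
set q := psi _; set a := mode_phase m x; set b := mode_phase k x.
suff : (site m < site k)%N (+) (odd k && (site m == site k)) (+)
       ((site k < site m)%N (+) (odd m && (site k == site m))) = true.
  set s := (_ (+) (odd k && _)); set t := (_ (+) (odd m && _)) => /(canRL (addbK _)) ->.
  by rewrite signr_addb expr1; ring.
rewrite [site k == _]eq_sym; case: (eqVneq (site m) (site k)) => [E|ne].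
  rewrite E ltnn /= !andbT; case: (boolP (odd k (+) odd m)) => //.
  by rewrite negb_add => /eqP o; case/eqP: mk; apply: mode_eq.
rewrite !andbF !addbF; move: ne; rewrite -val_eqE /=.
by case: ltngtP.
Qed.

Lemma majoranaZ m (c : R[i]) psi phi : (forall x, phi x = c * psi x) ->
  forall x, majorana m phi x = c * majorana m psi x.
Proof. by move=> E x; rewrite !majorana_siteE E mulrCA. Qed.

Definition act w phi : state R L := foldr (fun m => majorana m) phi w.

Lemma act_cat u v phi : act (u ++ v) phi = act u (act v phi).
Proof. exact: foldr_cat. Qed.

Lemma actZ w (c : R[i]) psi phi : (forall x, phi x = c * psi x) ->
  forall x, act w phi x = c * act w psi x.
Proof. by elim: w => //= m w IH /IH; apply: majoranaZ. Qed.

(** The sign is independent of [phi], even if [m] occurs in [w]. *)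
Lemma majorana_act m w : exists s : bool, forall phi x,
  majorana m (act w phi) x = (-1) ^+ s * act w (majorana m phi) x.
Proof.
elim: w => [|k w [s IH]]; first by exists false => phi x; rewrite mul1r.
have [E|mk] := eqVneq m k.
  rewrite -E; exists s => phi x /=; apply: majoranaZ => {}x; exact: IH.
exists (~~ s) => phi x /=; rewrite majorana_anticommute // (majoranaZ _ (IH phi)).
by rewrite signrN mulNr.
Qed.

Lemma majorana_act_notin m w phi x : m \notin w ->
  majorana m (act w phi) x = (-1) ^+ size w * act w (majorana m phi) x.
Proof.
elim: w phi x => [|k w IH] phi x /=; first by rewrite mul1r.
rewrite inE negb_or => /andP[mk mw].
rewrite majorana_anticommute // (majoranaZ _ (fun z => IH phi z mw)).
by rewrite exprS mulN1r mulNr.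
Qed.

Lemma conjcM (c d : R[i]) : conjc (c * d) = conjc c * conjc d.
Proof. exact: rmorphM. Qed.

Lemma conjcN (c : R[i]) : conjc (- c) = - conjc c.
Proof. exact: rmorphN. Qed.

Definition inner_prod psi phi : R[i] := \sum_x conjc (psi x) * phi x.

Lemma inner_prodZr psi phi phi' (c : R[i]) : (forall x, phi' x = c * phi x) ->
  inner_prod psi phi' = c * inner_prod psi phi.
Proof. by move=> E; rewrite /inner_prod big_distrr; apply: eq_bigr => x _; rewrite E mulrCA. Qed.

Lemma inner_prodZl psi psi' phi (c : R[i]) : (forall x, psi' x = c * psi x) ->
  inner_prod psi' phi = conjc c * inner_prod psi phi.
Proof.
move=> E; rewrite /inner_prod big_distrr /=; apply: eq_bigr => x _.
by rewrite E conjcM mulrA.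
Qed.

Lemma conjc_sign (b : bool) : conjc ((-1) ^+ b : R[i]) = (-1) ^+ b.
Proof. by rewrite rmorphXn rmorphN1. Qed.

Lemma conjc_i : conjc 'i%C = - 'i%C :> R[i].
Proof. by apply/eqP; rewrite eq_complex /= oppr0 !eqxx. Qed.

Lemma majorana_adjoint m psi phi :
  inner_prod psi (majorana m phi) = inner_prod (majorana m psi) phi.
Proof.
rewrite /inner_prod (reindex_inj (can_inj (flip_siteK (site m)))) /=.
apply: eq_bigr => x _; rewrite !majorana_siteE flip_siteK conjcM mulrCA mulrA.
congr (_ * _); congr (_ * _).
rewrite mode_phase_flip ltnn eqxx andbT /= /mode_phase conjcM conjc_sign.
case: (odd m); last by rewrite rmorph1 expr0 mul1r.
by rewrite conjcM conjcN conjc_i conjc_sign expr1 mulN1r opprK mulNr mulrN opprK.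
Qed.

(** * Two dimer states with the same parities, assumed orthogonal *)

Section Uniqueness.
Variables (Omega : {set 'I_(2 * L) * 'I_(2 * L)}) (p : parities Omega).
Variables (psi psi' : state R L).
Hypotheses (dpsi : majorana_dimer p psi) (dpsi' : majorana_dimer p psi').
Hypothesis orth : inner_prod psi psi' = 0.

(** The factor is ['i%C] up to sign, hence purely imaginary; it is the same for both states because
    they share their parities. *)
Lemma dimer_partner m : exists k (c : R[i]), [/\ c != 0, conjc c = - c,
  forall x, majorana m psi x = c * majorana k psi x &
  forall x, majorana m psi' x = c * majorana k psi' x].
Proof.
have [[_ /(_ m)[[j k] [[jk mjk] _]]] _ H] := dpsi; have [_ _ H'] := dpsi'.
pose d : dimer Omega := exist _ (j, k) jk.
pose s : R[i] := (-1) ^+ p d.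
have ss : s * s = 1 by rewrite -signr_addb addbb.
have ii : 'i%C * 'i%C = -1 :> R[i] by rewrite -expr2 sqr_i.
have i0 : 'i%C != 0 :> R[i] by rewrite -sqrf_eq0 sqr_i oppr_eq0 oner_eq0.
have s0 : s != 0 by rewrite -sqrf_eq0 expr2 ss oner_eq0.
have is2 : 'i%C * s * (- 'i%C * s) = 1.
  transitivity (- ('i%C * 'i%C) * (s * s)); first by ring.
  by rewrite ii ss opprK mul1r.
have h x : majorana j psi x = - 'i%C * s * majorana k psi x.
  by have := H d x => /= /eqP; rewrite addr_eq0 => /eqP ->; rewrite !mulNr.
have h' x : majorana j psi' x = - 'i%C * s * majorana k psi' x.
  by have := H' d x => /= /eqP; rewrite addr_eq0 => /eqP ->; rewrite !mulNr.
case: mjk => ->.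
  exists k, (- 'i%C * s); split => //; first by rewrite mulf_neq0 // oppr_eq0.
  by rewrite conjcM conjcN conjc_i conjc_sign opprK mulNr opprK.
exists j, ('i%C * s); split; first by rewrite mulf_neq0.
- by rewrite conjcM conjc_i conjc_sign mulNr.
- by move=> x; rewrite h mulrA is2 mul1r.
- by move=> x; rewrite h' mulrA is2 mul1r.
Qed.

(** Moved next to its second occurrence, [m] squares to the identity, which leaves a shorter
    word. *)
Lemma word_cancel m w (n : nat) : (size w < n)%N ->
  (forall u, (size u < n)%N -> inner_prod psi (act u psi') = 0) ->
  m \in w -> inner_prod psi (act (m :: w) psi') = 0.
Proof.
move=> wn H /path.splitPr wE; case: wE wn => u v wn.
have [s E] := majorana_act m u.
rewrite (@inner_prodZr _ (act (u ++ v) psi') _ ((-1) ^+ s)).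
  by rewrite H ?mulr0 //; move: wn; rewrite !size_cat /= addnS => /ltnW.
by move=> x; rewrite /= !act_cat /= E majoranaK.
Qed.

(* If m and its partner k do not occur in w, moving the first letter m through
   the word and onto psi' gives a factor c, moving it onto psi gives
   conjc c = - c; hence the product vanishes. *)
Lemma words_orthogonal w : inner_prod psi (act w psi') = 0.
Proof.
(* Strong induction on the length; the empty word is the hypothesis [orth]. *)
elim: {w}(size w).+1 {-2}w (ltnSn (size w)) => // n IH [|m w] //= wn.
have IH' u : (size u < n)%N -> inner_prod psi (act u psi') = 0 by move=> un; apply: IH.
have [mw|mw] := boolP (m \in w); first exact: (word_cancel wn IH' mw).
have [k [c [c0 cc E E']]] := dimer_partner m.
have bra : inner_prod psi (act (m :: w) psi') = conjc c * inner_prod psi (act (k :: w) psi').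
  by rewrite /= !majorana_adjoint (inner_prodZl _ E).
have [kw|kw] := boolP (k \in w).
  by rewrite -[LHS]/(inner_prod psi (act (m :: w) psi')) bra (word_cancel wn IH' kw) mulr0.
have ket : inner_prod psi (act (m :: w) psi') = c * inner_prod psi (act (k :: w) psi').
  apply: inner_prodZr => x /=; rewrite !majorana_act_notin // (actZ _ E').
  by rewrite mulrCA.
move: bra; rewrite ket cc => /eqP; rewrite mulNr -addr_eq0 -mulr2n -mulr_natl !mulf_eq0.
by rewrite pnatr_eq0 /= => /orP[|/eqP ->]; rewrite ?(negPf c0) ?mulr0.
Qed.

Definition word_null phi := forall w, inner_prod psi (act w phi) = 0.

Lemma word_null_majorana m phi : word_null phi -> word_null (majorana m phi).
Proof. by move=> H w; have := H (w ++ [:: m]); rewrite act_cat. Qed.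

Lemma word_nullZ (c : R[i]) phi phi' : (forall x, phi' x = c * phi x) ->
  word_null phi -> word_null phi'.
Proof. by move=> E H w; rewrite (inner_prodZr _ (actZ w E)) H mulr0. Qed.

Lemma actD w phi1 phi2 phi : (forall x, phi x = phi1 x + phi2 x) ->
  forall x, act w phi x = act w phi1 x + act w phi2 x.
Proof.
elim: w => //= m w IH /IH {}IH x.
by rewrite !majorana_siteE IH mulrDr.
Qed.

Lemma word_nullD phi1 phi2 phi : (forall x, phi x = phi1 x + phi2 x) ->
  word_null phi1 -> word_null phi2 -> word_null phi.
Proof.
move=> E H1 H2 w; rewrite -[RHS]addr0 -{1}(H1 w) -(H2 w) /inner_prod -big_split.
by apply: eq_bigr => x _; rewrite (actD w E) mulrDr.
Qed.

Lemma mode_even (l : 'I_L) : (l.*2 < 2 * L)%N.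
Proof. by rewrite -mul2n ltn_pmul2l. Qed.

Lemma mode_odd (l : 'I_L) : (l.*2.+1 < 2 * L)%N.
Proof. by rewrite -doubleS -mul2n; rewrite mul2n -mul2n ?ltn_Sdouble; case: l => /= q; lia. Qed.

(** The Pauli Z on site [l] is [- 'i%C] times the product of its two modes, so the projection onto a
    bit value is a combination of words. *)
Lemma word_null_project l (c : bool) phi : word_null phi ->
  word_null [ffun x => (bits x l == c)%:R * phi x].
Proof.
move=> H; pose m0 := Ordinal (mode_even l); pose m1 := Ordinal (mode_odd l).
have s0 : site m0 = l by apply: val_inj; rewrite /= doubleK.
have s1 : site m1 = l by apply: val_inj; rewrite /= uphalf_double.
pose phi1 : state R L := [ffun x => 2^-1 * phi x].
pose phi2 : state R L := [ffun x => (- 'i%C * (-1) ^+ c / 2) * majorana m0 (majorana m1 phi) x].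
apply: (@word_nullD phi1 phi2).
- move=> x; rewrite ffunE [phi1 x]ffunE.
  have -> : phi2 x = (- 'i%C * (-1) ^+ c / 2) * majorana m0 (majorana m1 phi) x by rewrite ffunE.
  rewrite !majorana_siteE s0 s1 flip_siteK mode_phase_flip.
  rewrite /mode_phase s0 s1 /= odd_double eqxx ltnn /= mulr1.
  set pp := prefix_parity _ _; set s := bits x l; set q := phi x.
  have pq : (-1) ^+ pp * (-1) ^+ pp = 1 :> R[i] by rewrite -signr_addb addbb.
  have n2 : 2 != 0 :> R[i] by rewrite pnatr_eq0.
  have ii : 'i%C * 'i%C = -1 :> R[i] by rewrite -expr2 sqr_i.
  transitivity ((1 + (-1) ^+ (c (+) s)) / 2 * q).
    congr (_ * _); rewrite -negb_add addbC; case: (c (+) s) => /=.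
      by rewrite expr1 subrr mul0r.
    by rewrite expr0 (_ : 1 + 1 = 2%:R) // divff.
  rewrite signr_addb; 
  transitivity (2^-1 * q + ('i%C * 'i%C) * (-1) ^+ true * (-1) ^+ c * (-1) ^+ s *
    ((-1) ^+ pp * (-1) ^+ pp) / 2 * q); last by ring.
  by rewrite ii pq expr1; ring.
- by apply: word_nullZ H => x; rewrite ffunE.
- apply: (@word_nullZ _ (majorana m0 (majorana m1 phi))); last by do 2!apply: word_null_majorana.
  by move=> x; rewrite ffunE.
Qed.

Lemma word_null_indicator y : word_null psi' -> word_null [ffun x => (x == y)%:R * psi' x].
Proof.
move=> H.
have G (s : seq 'I_L) : word_null [ffun x => (all (fun l => bits x l == bits y l) s)%:R * psi' x].
  elim: s => [|l s IH]; first by apply: (word_nullZ (c := 1)) H => x; rewrite ffunE.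
  apply: (word_nullZ (c := 1)) (word_null_project l (bits y l) IH) => x.
  by rewrite !ffunE mul1r mulrA -natrM mulnb.
apply: (word_nullZ (c := 1)) (G (enum 'I_L)) => x; rewrite !ffunE mul1r.
congr (_%:R * _); congr nat_of_bool; apply/eqP/allP => [-> //|E].
by apply: bits_inj => l; have := E l; rewrite mem_enum => /(_ isT)/eqP.
Qed.

(** Majorana words act irreducibly: projections and flips lead from [psi'] to any basis vector, so
    that every amplitude of [psi] would vanish. *)
Lemma dimer_not_orthogonal : False.
Proof.
have [_ n0 _] := dpsi; have [_ n0' _] := dpsi'.
have [z pz] : exists z, psi z != 0.
  apply/existsP; apply: contraNT n0; rewrite negb_exists => /forallP h.
  by apply/eqP/ffunP => x; rewrite ffunE; apply/eqP; rewrite -[_ == _]negbK h.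
have [y py] : exists y, psi' y != 0.
  apply/existsP; apply: contraNT n0'; rewrite negb_exists => /forallP h.
  by apply/eqP/ffunP => x; rewrite ffunE; apply/eqP; rewrite -[_ == _]negbK h.
pose delta t : state R L := [ffun x => (x == t)%:R].
have dy : word_null (delta y).
  apply: (word_nullZ (c := (psi' y)^-1)) (word_null_indicator y words_orthogonal) => x.
  rewrite !ffunE; case: eqP => [->|_]; last by rewrite mul0r mulr0.
  by rewrite mul1r mulVf.
(* Interpolates from [y] to [z]; one more site is either no change or a flip, performed by the even
   mode of that site. *)
pose t (s : seq 'I_L) : config L := [ffun l => if l \in s then z l else y l].
have dt s : word_null (delta (t s)).
  elim: s => [|l s IH].
    suff -> : t [::] = y by []. by apply/ffunP => l; rewrite ffunE.
  pose y1 := t s.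
  have [E|E] := eqVneq (bits y1 l) (bits z l).
    suff -> : t (l :: s) = t s by [].
    apply/ffunP => l'; rewrite !ffunE inE; case: eqVneq => // -> /=.
    by apply: bit_inj; move: E; rewrite /bits ffunE; case: ifP.
  have tE : t (l :: s) = flip_site l y1.
    apply: bits_inj => l'; rewrite bits_flip_site; case: (eqVneq l' l) => [->|ne].
      rewrite addbT; move: E; rewrite [bits (t _) l]/bits ffunE inE eqxx /= -/(bits z l).
      by case: (bits y1 l); case: (bits z l).
    by rewrite addbF /bits !ffunE inE (negPf ne).
  pose m0 := Ordinal (mode_even l).
  have s0 : site m0 = l by apply: val_inj; rewrite /= doubleK.
  apply: (word_nullZ (c := (mode_phase m0 (flip_site l y1))^-1)) (word_null_majorana m0 IH) => x.
  have nz : mode_phase m0 (flip_site l y1) != 0.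
    apply/eqP => E0; have := mode_phase_sqr m0 (flip_site l y1).
    by rewrite E0 mul0r => /esym/eqP; rewrite oner_eq0.
  rewrite majorana_siteE s0 !ffunE tE -[in RHS](inj_eq (can_inj (flip_siteK l))) flip_siteK.
  by case: eqP => [->|_]; rewrite ?mulr0 // mulr1 mulVf.
have := dt (enum 'I_L) [::]; rewrite /= /inner_prod (bigD1 z) //= big1 => [|x xz].
  rewrite addr0 ffunE (_ : z == _) ?mulr1 => [/eqP|]; first by rewrite fmorph_eq0 (negPf pz).
  by apply/eqP/ffunP => l; rewrite ffunE mem_enum.
rewrite ffunE (_ : (x == _) = false) ?mulr0 //; apply/negbTE.
by apply: contra xz => /eqP ->; apply/eqP/ffunP => l; rewrite ffunE mem_enum.
Qed.
End Uniqueness.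
End Words.

(** * The pairing of the boundary modes *)

Section Pairing.
Variables (R : realType) (P : {fset 'M[R]_3}) (N : nat) (bd : N.-tuple (P * 'I_5)).
Hypothesis tileP : forall g, g \in P -> tile g.
Hypothesis bdP : clockwise_boundary bd.
Implicit Types (m u v : 'I_(2 * N)) (x y : flag R).

(* The first mode of a boundary side belongs to the strand along the line through
   the end vertex of the side, the second to that through its initial vertex. *)
Definition mode_flag m : flag R :=
  let d := bd_side bd (site m) in
  (d, if odd m then prev_label d.1 d.2 else next_label d.1 d.2).

Lemma mode_flag_boundary m : boundary_flag P (mode_flag m).
Proof.
split; first exact: bd_side_in; last exact: bd_side_out.
by rewrite /flag_adj /=; case: ifP => _; rewrite ?prev_label_adj ?next_label_adj.
Qed.

Lemma mode_flag_clockwise m : clockwise_flag (mode_flag m) = ~~ odd m.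
Proof.
rewrite /clockwise_flag /=; case: ifP => _; last by rewrite eqxx.
by apply/eqP => /esym/next_label_neq_prev.
Qed.

Lemma mode_flag_inj : injective mode_flag.
Proof.
move=> u v E; apply: mode_eq.
  by apply: (bd_side_inj bdP); have := f_equal fst E.
by apply: negb_inj; rewrite -!mode_flag_clockwise E.
Qed.

Lemma mode_flag_surj x : boundary_flag P x -> exists m, mode_flag m = x.
Proof.
move=> [xP ax bx]; have [l lE] := bd_side_surj bdP xP bx.
have xE : x.1 = bd_side bd l by rewrite lE; case: (x.1).
pose k : nat := l.*2 + ~~ clockwise_flag x.
have kN : (k < 2 * N)%N.
  have := ltn_ord l; rewrite /k; case: (~~ _) => /=; lia.
have sk : site (Ordinal kN) = l.
  by apply: val_inj; rewrite /= /k addnC half_bit_double.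
exists (Ordinal kN); rewrite /mode_flag sk -xE [RHS]surjective_pairing.
congr (_, _); rewrite /= /k oddD odd_double oddb.
by rewrite [RHS](clockwise_flagP ax); case: clockwise_flag.
Qed.

Definition dimer_set : {set 'I_(2 * N) * 'I_(2 * N)} :=
  [set d : 'I_(2 * N) * 'I_(2 * N) |
    (d.1 < d.2)%N && `[< linked P (mode_flag d.1) (mode_flag d.2) >]].

Lemma linked_odd u v : linked P (mode_flag u) (mode_flag v) -> odd v = ~~ odd u.
Proof.
move=> uv; apply: negb_inj; rewrite -!mode_flag_clockwise.
apply: (linked_clockwise tileP _ uv); exact: mode_flag_boundary.
Qed.

(** Every strand entering the patch leaves it at a unique flag, and reversing it gives symmetry. Its
    two modes have opposite parity, so no mode is its own partner. *)
Lemma pairing_dimer_set : pairing dimer_set.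
Proof.
split=> [d|m]; first by rewrite inE => /andP[].
have [y [by_ my]] := linked_exists tileP (mode_flag_boundary m).
have [m' m'E] := mode_flag_surj by_; rewrite -{y}m'E in by_ my.
have mm' : linked P (mode_flag m') (mode_flag m) by apply: linked_sym.
have uniq_m' v : linked P (mode_flag m) (mode_flag v) -> v = m'.
  by move=> mv; apply: mode_flag_inj; apply: linked_unique mv my; apply: mode_flag_boundary.
have neq : m <> m' by move=> E; have := linked_odd my; rewrite -E; case: odd.
exists (if (m < m')%N then (m, m') else (m', m)); split.
  case: ltngtP => [lt|lt|/val_inj //]; split; rewrite ?inE /=; try by [left|right].
    by rewrite lt; apply/asboolP.
  by rewrite lt; apply/asboolP.
case=> u v; rewrite inE /= => -[/andP[uv /asboolP luv] [mE|mE]]; subst m.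
  by rewrite -(uniq_m' v luv) uv.
by rewrite -(uniq_m' u (linked_sym luv)) ltnNge ltnW.
Qed.

Variables (psi : state R N) (b : {ffun P -> bool}) (K : R[i]).
Hypothesis psiE : forall z : config N, psi z = K * net_state bd b z.

Lemma linked_majorana u v : ~~ odd u -> linked P (mode_flag u) (mode_flag v) ->
  exists p : bool, forall x : config N, majorana u psi x = (-1) ^+ p * 'i%C * majorana v psi x.
Proof.
move=> ou uv; have ov : odd v by rewrite (linked_odd uv).
have [n nuv] := uv.
have cu : clockwise_flag (mode_flag u) by rewrite mode_flag_clockwise.
have cv : ~~ clockwise_flag (mode_flag v) by rewrite mode_flag_clockwise negbK.
have bu := mode_flag_boundary u; have bv := mode_flag_boundary v.
have [e eP] := net_flip tileP bdP bu bv nuv cu cv erefl erefl.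
apply: (@majorana_pair _ _ u v (site u) (site v) psi (e b)) => //.
  exact: (run_ends_neq bu bv nuv cu cv erefl erefl).
by move=> y; rewrite !psiE eP mulrCA.
Qed.

Lemma dimer_parity_exists u v : linked P (mode_flag u) (mode_flag v) ->
  exists p : bool, forall x : config N, majorana u psi x + 'i%C * (-1) ^+ p * majorana v psi x = 0.
Proof.
move=> uv; have [ou|ou] := boolP (odd u); last first.
  have [p E] := linked_majorana ou uv; exists (~~ p) => x.
  by rewrite E signrN; ring.
(* [linked_majorana] puts the even mode first, so the strand is reversed when [u] is odd. *)
have ov : ~~ odd v by rewrite (linked_odd uv) ou.
have [p E] := linked_majorana ov (linked_sym uv); exists p => x.
rewrite E; set z := majorana u psi x.
have ss : (-1) ^+ p * (-1) ^+ p = 1 :> R[i] by rewrite -signr_addb addbb.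
have ii : 'i%C * 'i%C = -1 :> R[i] by rewrite -expr2 sqr_i.
transitivity (z + ('i%C * 'i%C) * ((-1) ^+ p * (-1) ^+ p) * z); first by ring.
by rewrite ss ii mulr1 mulN1r subrr.
Qed.

Hypothesis psi0 : psi != 0.

Lemma dimer_parities_exist : exists p : parities dimer_set, majorana_dimer p psi.
Proof.
have H (d : dimer dimer_set) : exists p : bool, forall x : config N,
    majorana (val d).1 psi x + 'i%C * (-1) ^+ p * majorana (val d).2 psi x = 0.
  case: d => d dO; apply: dimer_parity_exists.
  by have := dO; rewrite inE => /andP[_ /asboolP].
exists [ffun d => projT1 (cid (H d))]; split => //; first exact: pairing_dimer_set.
move=> d x; have -> : [ffun d => projT1 (cid (H d))] d = projT1 (cid (H d)).
  by rewrite ffunE.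
exact: projT2 (cid (H d)) x.
Qed.
End Pairing.

(** If the parities differed at a dimer, the difference of the two relations would make its second
    mode annihilate [psi]; but that operator is an involution. *)
Lemma majorana_dimer_parity_unique (R : realType) (L : nat)
    (Omega : {set 'I_(2 * L) * 'I_(2 * L)}) (p p' : parities Omega) (psi : state R L) :
  majorana_dimer p psi -> majorana_dimer p' psi -> p = p'.
Proof.
move=> [_ psi0 H] [_ _ H']; apply/ffunP => d; apply/eqP.
apply: contraNT psi0 => pp'; rewrite -(majoranaK (val d).2 psi).
suff E : majorana (val d).2 psi = 0.
  by rewrite E; apply/eqP/ffunP => x; rewrite majorana_siteE !ffunE mulr0.
apply/ffunP => x; rewrite [RHS]ffunE; have := etrans (H d x) (esym (H' d x)) => /addrI/eqP.
rewrite -!mulrA -subr_eq0 -mulrBr -mulrBl !mulf_eq0 => /or3P[| |/eqP //].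
  by rewrite -sqrf_eq0 sqr_i oppr_eq0 oner_eq0.
have n2 : (1 : R[i]) + 1 != 0 by rewrite (_ : 1 + 1 = 2%:R) ?pnatr_eq0.
move: pp'; case: (p d); case: (p' d) => //= _.
  by rewrite expr0 expr1 -opprD oppr_eq0 (negPf n2).
by rewrite expr0 expr1 opprK (negPf n2).
Qed.

Lemma conjc_net_state (R : realType) (P : {fset 'M[R]_3}) (N : nat)
    (bd : N.-tuple (P * 'I_5)) (b : {ffun P -> bool}) y :
  conjc (net_state bd b y) = net_state bd b y.
Proof.
rewrite ffunE (rmorph_sum (@conjc R)); apply: eq_bigr => X _.
rewrite /net_weight (rmorph_prod (@conjc R)); apply: eq_bigr => g _.
by rewrite /tau; case: ifP => _; [exact: conjc_sign|exact: (rmorph0 (@conjc R))].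
Qed.

Theorem theorem2 (R : realType) (P : {fset 'M[R]_3}) (N : nat)
    (bd : N.-tuple (P * 'I_5)) (start : P -> 'I_5)
    (code : bool -> state R 5) :
  pentagon_patch P ->
  clockwise_boundary bd ->
  (forall c : bool, code_state c (code c)) ->
  exists Omega : {set 'I_(2 * N) * 'I_(2 * N)},
    [/\ pairing Omega,
        forall b : {ffun P -> bool},
          exists! p : parities Omega,
            majorana_dimer p (boundary_state bd start code b) &
        forall (b b' : {ffun P -> bool}) (p : parities Omega),
          majorana_dimer p (boundary_state bd start code b) ->
          majorana_dimer p (boundary_state bd start code b') ->
          b = b'].
Proof.
move=> [_ tileP _ _] bdP codeP.
have [alpha [alpha0 alphaE]] : exists alpha : bool -> R[i], (forall c, alpha c != 0) /\
    forall c x, code c x = alpha c * tau _ c (bits x).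
  have [a1 a10 a1E] := code_stateE (codeP true).
  have [a0 a00 a0E] := code_stateE (codeP false).
  by exists (fun c => if c then a1 else a0); split; case.
have psiE b := @boundary_stateE R P N bd start code alpha b alphaE.
pose K (b : {ffun P -> bool}) := \prod_g alpha (b g).
have K0 b : K b != 0 by apply/prodf_neq0 => g _.
have [G G0 GE] := overlapE tileP [set: P].
have gram b b' := etrans (net_state_gram bdP b b') (GE b b').
(* A vanishing state would give a zero diagonal Gram entry, which is [G]. *)
have psi0 b : boundary_state bd start code b != 0.
  apply: contraNneq G0 => E; have := gram b b.
  have -> : [forall g in [set: P], b g == b g] by apply/forall_inP.
  rewrite mul1r => <-; rewrite big1 // => y _.
  have : net_state bd b y = 0.
    by apply: (mulfI (K0 b)); rewrite mulr0 -psiE E ffunE.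
  by move=> ->; rewrite mul0r.
exists (dimer_set bd); split; first exact: pairing_dimer_set.
  move=> b; have [p pP] := dimer_parities_exist tileP bdP (psiE b) (psi0 b).
  by exists p; split => // p'; apply: majorana_dimer_parity_unique.
move=> b b' p dp dp'; apply/ffunP => g; apply: contrapT => /eqP bb'.
(* Different inputs give orthogonal states. The amplitudes of [net_state] are real, so the bilinear
   [gram] computes the inner product. *)
apply: (dimer_not_orthogonal dp dp').
rewrite /inner_prod (eq_bigr (fun y =>
  conjc (K b) * K b' * (net_state bd b y * net_state bd b' y))).
  rewrite -big_distrr /= gram (_ : [forall _ in _, _] = false) ?mul0r ?mulr0 //.
  by apply/negbTE; rewrite negb_forall; apply/existsP; exists g; rewrite inE bb'.
by move=> y _; rewrite !psiE conjcM conjc_net_state mulrACA.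
Qed.
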